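(* Let $p$ be an odd prime, $r\ge 1$ and $s\ge 0$ integers; if $p=3$ assume $r\ge\min\{2,s\}$. For $k\ge 1$ let $$R_k=\{1+c_1p+c_2p^2+\cdots+c_{\min(r,k)-1}p^{\min(r,k)-1} : 0\le c_i\le p-1\},$$ and let $L_{r+k}$ be the unique subfield of $\mathbb{Q}(\zeta_{p^{r+k}})$ with $[\mathbb{Q}(\zeta_{p^{r+k}}):L_{r+k}]=p-1$. Put $$\alpha_s=1+\sum_{k=1}^{s}\sum_{t\in R_k}\mathrm{Tr}_{\mathbb{Q}(\zeta_{p^{r+k}})/L_{r+k}}(\zeta_{p^{r+k}}^{t})$$ (so $\alpha_0=1$) and $G_s=\mathrm{Gal}(\mathbb{Q}(\zeta_{p^{r+s}})/\mathbb{Q}(\zeta_{p^r}))$. Then $\mathcal{A}_{\mathbb{Q}(\zeta_{p^{r+s}})/\mathbb{Q}(\zeta_{p^r})}=\mathcal{M}_{\mathbb{Q}(\zeta_{p^r})[G_s]}$ and $\mathbb{Z}[\zeta_{p^{r+s}}]=\mathcal{A}_{\mathbb{Q}(\zeta_{p^{r+s}})/\mathbb{Q}(\zeta_{p^r})}\cdot\alpha_s$. In particular $\mathbb{Q}(\zeta_{p^{r+s}})/\mathbb{Q}(\zeta_{p^r})$ is Leopoldt.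
   Context: Roots of unity are chosen compatibly: for each $k$ a primitive $k$-th root of unity $\zeta_k\in\mathbb{C}$ is fixed such that $\zeta_l^{l/k}=\zeta_k$ whenever $k\mid l$. For a finite Galois extension of number fields $L/K$ with group $G$, the associated order is $\mathcal{A}_{L/K}=\{x\in K[G] : x(\mathcal{O}_L)\subseteq\mathcal{O}_L\}$. For abelian $G$, $\mathcal{M}_{K[G]}$ denotes the (unique) maximal $\mathcal{O}_K$-order in $K[G]$. An extension $L/K$ with $L/\mathbb{Q}$ abelian is Leopoldt if $\mathcal{O}_L$ is free over $\mathcal{A}_{L/K}$. *)

(* Defs.v *)
From HB Require Import structures.
From mathcomp Require Import all_boot all_order all_fingroup all_algebra.
From mathcomp Require Import all_solvable all_field.

Set Implicit Arguments.
Unset Strict Implicit.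
Unset Printing Implicit Defensive.

Import GRing.Theory.
Local Open Scope ring_scope.

(* The alias keeps the convolution product apart from the pointwise product   *)
(* that the library puts on {ffun gT -> F}.                                   *)
Definition group_alg (F : fieldType) (gT : finGroupType) : Type :=
  {ffun gT -> F}.

Section GroupAlgebra.
Variables (F : fieldType) (gT : finGroupType).
Local Notation FG := (group_alg F gT).

HB.instance Definition _ := GRing.Zmodule.copy FG {ffun gT -> F}.

Definition ga_one : FG := [ffun g : gT => (g == 1%g)%:R].
Definition ga_mul (x y : FG) : FG :=
  [ffun g : gT => \sum_(h : gT) x h * y (h^-1 * g)%g].
Definition ga_scale (a : F) (x : FG) : FG := [ffun g : gT => a * x g].

Fact ga_mulA : associative ga_mul.
Proof.
move=> x y z; apply/ffunP=> g; rewrite !ffunE.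
under eq_bigr => h _ do rewrite ffunE mulr_sumr.
under [RHS]eq_bigr => h _ do rewrite ffunE mulr_suml.
rewrite [RHS]exchange_big /=; apply: eq_bigr => h _.
rewrite [RHS](reindex_inj (mulgI h)) /=; apply: eq_bigr => k _.
by rewrite mulKg invMg !mulgA mulrA.
Qed.

Fact ga_mul1 : left_id ga_one ga_mul.
Proof.
move=> x; apply/ffunP=> g; rewrite ffunE (bigD1 1%g) //= ffunE eqxx mul1r.
rewrite invg1 mul1g big1 ?addr0 // => h /negPf hn1.
by rewrite ffunE hn1 mul0r.
Qed.

Fact ga_mulr1 : right_id ga_one ga_mul.
Proof.
move=> x; apply/ffunP=> g; rewrite ffunE (bigD1 g) //= ffunE mulVg eqxx mulr1.
rewrite big1 ?addr0 // => h hng.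
by rewrite ffunE -eq_mulVg1 (negPf hng) mulr0.
Qed.

Fact ga_mulDl : left_distributive ga_mul +%R.
Proof.
move=> x y z; apply/ffunP=> g; rewrite !ffunE -big_split /=.
by apply: eq_bigr => h _; rewrite ffunE mulrDl.
Qed.

Fact ga_mulDr : right_distributive ga_mul +%R.
Proof.
move=> x y z; apply/ffunP=> g; rewrite !ffunE -big_split /=.
by apply: eq_bigr => h _; rewrite ffunE mulrDr.
Qed.

Fact ga_one_neq0 : ga_one != 0.
Proof.
by apply/eqP => /ffunP/(_ 1%g)/eqP; rewrite !ffunE eqxx oner_eq0.
Qed.

HB.instance Definition _ := GRing.Zmodule_isNzRing.Build FG
  ga_mulA ga_mul1 ga_mulr1 ga_mulDl ga_mulDr ga_one_neq0.

Fact ga_scaleA a b x : ga_scale a (ga_scale b x) = ga_scale (a * b) x.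
Proof. by apply/ffunP=> g; rewrite !ffunE mulrA. Qed.
Fact ga_scale1 : left_id 1 ga_scale.
Proof. by move=> x; apply/ffunP=> g; rewrite !ffunE mul1r. Qed.
Fact ga_scaleDr : right_distributive ga_scale +%R.
Proof. by move=> a x y; apply/ffunP=> g; rewrite !ffunE mulrDr. Qed.
Fact ga_scaleDl x : {morph ga_scale^~ x : a b / a + b}.
Proof. by move=> a b; apply/ffunP=> g; rewrite !ffunE mulrDl. Qed.

HB.instance Definition _ := GRing.Zmodule_isLmodule.Build F FG
  ga_scaleA ga_scale1 ga_scaleDr ga_scaleDl.

Fact ga_scaleAl (a : F) (x y : FG) : a *: (x * y) = (a *: x) * y.
Proof.
apply/ffunP=> g; rewrite !ffunE mulr_sumr.
by apply: eq_bigr => h _; rewrite ffunE mulrA.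
Qed.

HB.instance Definition _ := GRing.Lmodule_isLalgebra.Build F FG ga_scaleAl.

Fact ga_scaleAr (a : F) (x y : FG) : a *: (x * y) = x * (a *: y).
Proof.
apply/ffunP=> g; rewrite !ffunE mulr_sumr.
by apply: eq_bigr => h _; rewrite ffunE mulrCA.
Qed.

HB.instance Definition _ := GRing.Lalgebra_isAlgebra.Build F FG ga_scaleAr.

End GroupAlgebra.

Section Orders.
Variables (F : fieldType) (O : F -> Prop) (A : algType F).

(* O-orders in A: subrings that are finitely generated as O-modules and span  *)
(* A over F; ord_fg makes Lam an O-submodule, so that O%:A is inside Lam.     *)
Record is_order (Lam : A -> Prop) : Prop := IsOrder {
  ord_one : Lam 1;
  ord_sub : forall x y, Lam x -> Lam y -> Lam (x - y);
  ord_mul : forall x y, Lam x -> Lam y -> Lam (x * y);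
  ord_fg : exists n (b : 'I_n -> A), forall x : A,
    Lam x <->
    exists c : 'I_n -> F, (forall i, O (c i)) /\ x = \sum_(i < n) c i *: b i;
  ord_span : forall x : A, exists n (c : 'I_n -> F) (b : 'I_n -> A),
    (forall i, Lam (b i)) /\ x = \sum_(i < n) c i *: b i
}.

Definition is_maximal_order (Lam : A -> Prop) : Prop :=
  is_order Lam /\
  forall Lam' : A -> Prop, is_order Lam' ->
    (forall x, Lam x -> Lam' x) -> forall x, Lam' x -> Lam x.

Definition is_unique_maximal_order (Lam : A -> Prop) : Prop :=
  is_maximal_order Lam /\
  forall M : A -> Prop, is_maximal_order M -> forall x, M x <-> Lam x.

End Orders.

Section GaloisModules.
Variable L : splittingFieldType rat.
Implicit Types K E : {subfield L}.

Definition ring_of_integers E (x : L) : Prop :=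
  x \in E /\ integralOver (intr : int -> L) x.

Definition Zadjoin (z x : L) : Prop :=
  exists q : {poly int}, x = (map_poly intr q).[z].

Definition gal_alg K E : Type := group_alg (subvs_of K) [subg 'Gal(E / K)].

HB.instance Definition _ K E := GRing.Algebra.on (gal_alg K E).

(* In the library (g * h) y = h (g y) for g, h in 'Gal(E / K), so this makes  *)
(* E a right module when the group is not abelian; the set                    *)
(* associated_order does not depend on this convention.                       *)
Definition gal_act K E (x : gal_alg K E) (y : L) : L :=
  \sum_(g : [subg 'Gal(E / K)]) vsval (x g) * sgval g y.

Definition associated_order K E (x : gal_alg K E) : Prop :=
  forall y, ring_of_integers E y -> ring_of_integers E (gal_act x y).

Definition integers_in K (c : subvs_of K) : Prop :=
  ring_of_integers K (vsval c).

Definition integers_free_over_associated_order K E : Prop :=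
  exists n (b : 'I_n -> L),
    (forall i, ring_of_integers E (b i)) /\
    forall y, ring_of_integers E y ->
      exists! c : {ffun 'I_n -> gal_alg K E},
        (forall i, associated_order (c i)) /\
        y = \sum_(i < n) gal_act (c i) (b i).

Definition is_leopoldt K E : Prop :=
  [/\ (K <= E)%VS, galois 1 E, abelian 'Gal(E / 1)
    & integers_free_over_associated_order K E].

End GaloisModules.

Definition compatible_roots_of_unity (zeta : nat -> algC) : Prop :=
  (forall k, (0 < k)%N -> k.-primitive_root (zeta k)) /\
  (forall k l, (0 < l)%N -> (k %| l)%N -> zeta l ^+ (l %/ k) = zeta k).

Definition Rset (p r k : nat) : seq nat :=
  undup [seq (1 + \sum_(i < (minn r k).-1) c i * p ^ i.+1)%N
        | c : {ffun 'I_(minn r k).-1 -> 'I_p}].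

Definition alpha (L : splittingFieldType rat) (p r : nat)
    (Lsub : nat -> {subfield L}) (z : nat -> L) (s : nat) : L :=
  1 + \sum_(1 <= k < s.+1) \sum_(t <- Rset p r k)
        galTrace (Lsub k) <<1; z k>> (z k ^+ t).

(* Main.v *)
Require Import Defs.
From mathcomp Require Import all_boot all_order all_fingroup all_algebra.
From mathcomp Require Import all_solvable all_field.
From mathcomp Require Import zify ring.

Set Implicit Arguments.
Unset Strict Implicit.
Unset Printing Implicit Defensive.

Import Order.TTheory GRing.Theory Num.Theory.
Local Open Scope ring_scope.

(* Write zt for zeta_(p^(r+s)), om = zt^(p^r), and sg for the generator
   zt |-> zt^(1 + p^r) of G.  The ring morphism psi l : K[G] -> E mapping sg to
   om^l satisfies ker (psi l) <= Ann (zt^l), because modulo the minimal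
   polynomial X^M - om^(l M) of om^l over K, with M a power of p, the congruence
   (1 + p^r)^(p^m) = 1 + p^(r+m) mod p^(2r+m) shows that sg^M multiplies zt^l by
   om^(l M).  As the ring of integers of K(om^l) is O_K[om^l], an x in K[G] all
   of whose psi l x are integral acts on zt^l as an element of O_K[G] does, so x
   lies in the associated order; elements of orders have this property, hence
   the associated order contains every order.  In particular it contains the
   primitive idempotents of K[G], which correspond to the K-conjugacy classes of
   p^s-th roots of unity om^i.  alpha_s is a sum of powers zt^t in which every
   class is represented by om^t exactly once, so the idempotents separate its
   terms, and the translates of these terms under G and the powers of
   zeta_(p^r) are all the powers of zt. *)

(** * Rings Z[w] and integral elements *)

Section Zadjoin.
Variable L : splittingFieldType rat.
Implicit Types w x y : L.
Local Notation integral := (integralOver (intr : int -> L)).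

Lemma Zadjoin_int w (n : int) : Zadjoin w n%:~R.
Proof. by exists n%:P; rewrite map_polyC hornerC. Qed.

Lemma Zadjoin_gen w : Zadjoin w w.
Proof. by exists 'X; rewrite map_polyX hornerX. Qed.

Lemma Zadjoin_add w x y : Zadjoin w x -> Zadjoin w y -> Zadjoin w (x + y).
Proof. by case=> q -> [q' ->]; exists (q + q'); rewrite rmorphD hornerD. Qed.

Lemma Zadjoin_mul w x y : Zadjoin w x -> Zadjoin w y -> Zadjoin w (x * y).
Proof. by case=> q -> [q' ->]; exists (q * q'); rewrite rmorphM hornerM. Qed.

Lemma Zadjoin_opp w x : Zadjoin w x -> Zadjoin w (- x).
Proof. by case=> q ->; exists (- q); rewrite rmorphN hornerN. Qed.

Lemma Zadjoin_sub w x y : Zadjoin w x -> Zadjoin w y -> Zadjoin w (x - y).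
Proof. by move=> Zx Zy; apply: Zadjoin_add Zx (Zadjoin_opp Zy). Qed.

Lemma Zadjoin_nat w n : Zadjoin w n%:R.
Proof. exact: (Zadjoin_int w n). Qed.

Lemma Zadjoin_exp w x n : Zadjoin w x -> Zadjoin w (x ^+ n).
Proof.
move=> Zx; elim: n => [|n IH]; first exact: (Zadjoin_nat w 1).
by rewrite exprS; apply: Zadjoin_mul.
Qed.

Lemma Zadjoin_sum w (I : Type) (s : seq I) (P : pred I) (F : I -> L) :
  (forall i, P i -> Zadjoin w (F i)) -> Zadjoin w (\sum_(i <- s | P i) F i).
Proof.
move=> ZF; apply: big_ind ZF; first exact: (Zadjoin_nat w 0).
exact: Zadjoin_add.
Qed.

Lemma Zadjoin_memv w x : Zadjoin w x -> x \in <<1; w>>%VS.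
Proof.
case=> q ->; rewrite horner_coef; apply: memv_suml => i _.
rewrite coef_map rpredM ?rpredX ?memv_adjoin //.
by rewrite (subvP (subv_adjoin 1 w)) // rpred_int.
Qed.

Lemma integral_int (n : int) : integral n%:~R.
Proof. exact: integral_id. Qed.

Lemma integral_exp x n : integral x -> integral (x ^+ n).
Proof.
move=> Zx; elim: n => [|n IH]; first exact: (integral_nat _ 1).
by rewrite exprS; apply: integral_mul.
Qed.

Lemma integral_sum (I : Type) (s : seq I) (P : pred I) (F : I -> L) :
  (forall i, P i -> integral (F i)) -> integral (\sum_(i <- s | P i) F i).
Proof.
move=> ZF; apply: (big_ind (fun x => integral x)) ZF; first exact: integral0.
exact: integral_add.
Qed.

Lemma integral_Zadjoin w x : integral w -> Zadjoin w x -> integral x.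
Proof.
move=> Zw [q ->]; rewrite horner_coef; apply: integral_sum => i _.
rewrite coef_map; apply: integral_mul (integral_int _) (integral_exp _ Zw).
Qed.

Lemma integral_gal (E : {subfield L}) (g : gal_of E) x :
  integral x -> integral (g x).
Proof.
case=> q mq qx; exists q => //.
have -> : map_poly intr q = map_poly g (map_poly intr q).
  by rewrite -map_poly_comp; apply: eq_map_poly => n /=; rewrite rmorph_int.
exact: rmorph_root.
Qed.

Lemma integral_prim_root n w : n.-primitive_root w -> integral w.
Proof.
move=> w_n; exists ('X^n - 1).
  by rewrite -[1]polyC1 monicXnsubC ?(prim_order_gt0 w_n).
rewrite rmorphB /= map_polyXn rmorph1 rootE.
by rewrite hornerD hornerN hornerXn hornerC (prim_expr_order w_n) subrr.
Qed.

Lemma ring_of_integers_Zadjoin w x :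
  integral w -> Zadjoin w x -> ring_of_integers <<1; w>> x.
Proof. by move=> Zw Zx; split; [exact: Zadjoin_memv|exact: integral_Zadjoin Zx]. Qed.

(** The embedding [iota] carries [x] to a rational algebraic integer of [algC], hence to an
    integer. *)
Lemma rational_integral (iota : {rmorphism L -> algC}) x :
  x \in 1%VS -> integral x -> exists n : int, x = n%:~R.
Proof.
case/vlineP=> c -> [q mq]; rewrite -(fmorph_root iota) -map_poly_comp => qx.
have ix : iota c%:A = ratr c by rewrite alg_num_field fmorph_rat.
have /intrP[n Dn] : iota c%:A \in Num.int.
  apply: Cint_rat_Aint; first by rewrite ix; apply/CratP; exists c.
  apply: (root_monic_Aint qx).
    rewrite (eq_map_poly (g := intr)); last by move=> n /=; rewrite rmorph_int.
    by rewrite monic_map.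
  by apply/polyOverP=> i; rewrite coef_map /= rmorph_int rpred_int.
by exists n; apply: (fmorph_inj iota); rewrite Dn rmorph_int.
Qed.

End Zadjoin.

Lemma prim_root_neq0 (F : fieldType) n (w : F) : n.-primitive_root w -> w != 0.
Proof. by move=> w_n; rewrite (prim_root_eq0 w_n) -lt0n (prim_order_gt0 w_n). Qed.

(** * Cyclotomic extensions of the rationals *)

Section CyclotomicGalois.
Variables (L : splittingFieldType rat) (n : nat) (w : L).
Hypothesis w_n : n.-primitive_root w.

Lemma natr_neq0 m : (0 < m)%N -> m%:R != 0 :> L.
Proof.
move=> m_gt0; have -> : m%:R = (m%:R : rat)%:A :> L by rewrite scaler_nat.
by rewrite scaler_eq0 oner_eq0 orbF pnatr_eq0 -lt0n.
Qed.

Lemma galois_prim_root : galois 1 <<1; w>>.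
Proof.
apply/splitting_galoisField; exists ('X^n - 1); split.
- by rewrite rpredB ?rpred1 // rpredX // polyOverX.
- by rewrite separable_Xn_sub_1 // natr_neq0 ?(prim_order_gt0 w_n).
exists [seq w ^+ i | i <- index_iota 0 n].
  by rewrite big_map -(factor_Xn_sub_1 w_n) eqpxx.
apply/eqP; rewrite eqEsubv; apply/andP; split.
  apply/Fadjoin_seqP; split; first exact: subv_adjoin.
  by move=> _ /mapP[i _ ->]; rewrite rpredX // memv_adjoin.
apply/FadjoinP; split; first exact: subv_adjoin_seq.
have n_gt0 := prim_order_gt0 w_n.
(* For [n = 1] the index range contains only 0, whence [1 %% n] in place of 1. *)
apply: seqv_sub_adjoin; apply/mapP; exists (1 %% n)%N.
  by rewrite mem_index_iota ltn_pmod.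
by rewrite (prim_expr_mod w_n) expr1.
Qed.

Lemma gal_prim_root_eq (g h : gal_of <<1; w>>) : g w = h w -> g = h.
Proof.
move=> gh; apply/eqP/gal_eqP => _ /Fadjoin_polyP[_ /polyOver1P[q ->] ->].
rewrite -!horner_map /= gh -!map_poly_comp; congr (_.[_]).
by apply: eq_map_poly => c /=; rewrite !linearZ /= !rmorph1.
Qed.

Lemma abelian_gal_prim_root : abelian 'Gal(<<1; w>> / 1).
Proof.
apply/centsP=> g _ h _; apply: gal_prim_root_eq; rewrite !galM ?memv_adjoin //.
exact: (aut_unity_rootC _ _ (prim_order_gt0 w_n) (prim_expr_order w_n)).
Qed.

(** Irreducibility of the cyclotomic polynomial: transported along [iota], the minimal polynomial of
    [w] is a multiple of it, so [w ^+ a] is also a root and hence a conjugate of [w]. *)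
Lemma gal_prim_root_exists (iota : {rmorphism L -> algC}) a : coprime a n ->
  exists2 g : gal_of <<1; w>>, g \in 'Gal(<<1; w>> / 1)%g & g w = w ^+ a.
Proof.
move=> a_n; have /and3P[sKE _ nKE] := galois_prim_root.
apply: (normalField_root_minPoly sKE nKE); first exact: memv_adjoin.
have /polyOver1P[q Dq] := minPolyOver 1 w.
have iw_n : n.-primitive_root (iota w) by rewrite fmorph_primitive_root.
have Diq x : root (map_poly (GRing.in_alg L) q) x = root (map_poly ratr q) (iota x).
  rewrite -(fmorph_root iota) -map_poly_comp; congr root.
  by apply: eq_map_poly => c /=; rewrite alg_num_field fmorph_rat.
rewrite Dq Diq rmorphXn; have := root_minPoly 1 w; rewrite Dq Diq.
have [m [Dm _] ->] := minCpolyP (iota w); case/dvdpP=> d ->.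
rewrite rmorphM rootM /= -Dm (minCpoly_cyclotomic iw_n) root_cyclotomic //.
by rewrite prim_root_exp_coprime // a_n orbT.
Qed.

End CyclotomicGalois.

(** * Integers of prime power cyclotomic fields *)

(** The factorization of ['X^n - 1] is evaluated at [y^-1] and multiplied by [y ^+ n]. *)
Lemma prod_one_sub_prim_root (F : fieldType) n (v y : F) :
  n.-primitive_root v -> \prod_(0 <= i < n) (1 - y * v ^+ i) = 1 - y ^+ n.
Proof.
move=> v_n; have n_gt0 := prim_order_gt0 v_n.
have [-> | y_nz] := eqVneq y 0.
  by rewrite big1 ?expr0n ?gtn_eqF ?subr0 // => i _; rewrite mul0r subr0.
have := congr1 (fun q => q.[y^-1]) (factor_Xn_sub_1 v_n).
rewrite horner_prod hornerD hornerN hornerXn hornerC exprVn.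
move=> /(congr1 ( *%R (y ^+ n))).
rewrite mulrBr mulr1 mulfV ?expf_neq0 // => <-.
rewrite -[X in y ^+ X]subn0 -prodr_const_nat -big_split; apply: eq_bigr => i _ /=.
by rewrite hornerXsubC mulrBr mulfV.
Qed.

(** Both sides are the value at 1 of [('X^n - 1) / ('X - 1)], as a product of linear factors and as
    a geometric sum. *)
Lemma prod_one_sub_prim_root1 (F : fieldType) n (v : F) :
  n.-primitive_root v -> \prod_(1 <= i < n) (1 - v ^+ i) = n%:R.
Proof.
move=> v_n; have n_gt0 := prim_order_gt0 v_n.
have /eqP := factor_Xn_sub_1 v_n; rewrite big_ltn // expr0 subrX1.
rewrite (inj_eq (mulfI _)) ?polyXsubC_eq0 // => /eqP/(congr1 (horner^~ 1)).
rewrite horner_prod horner_sum => Dn; transitivity (\sum_(i < n) (1 : F)).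
    transitivity (\prod_(1 <= i < n) ('X - (v ^+ i)%:P).[1]).
      by apply: eq_bigr => i _; rewrite hornerXsubC.
    by rewrite Dn; apply: eq_bigr => i _; rewrite hornerXn expr1n.
by rewrite sumr_const card_ord.
Qed.

Section RingOfIntegers.
Variables (L : splittingFieldType rat) (iota : {rmorphism L -> algC}).
Variables (p k : nat) (w : L).
Hypotheses (p_pr : prime p) (w_pk : (p ^ k.+1)%N.-primitive_root w).
Local Notation N := (p ^ k.+1)%N.
Local Notation integral := (integralOver (intr : int -> L)).

Lemma Zadjoin_sub1_dvd a : exists2 u, Zadjoin w u & 1 - w ^+ a = (1 - w) * u.
Proof.
exists (\sum_(i < a) w ^+ i); last by rewrite -opprB subrX1 -mulNr opprB.
by apply: Zadjoin_sum => i _; apply/Zadjoin_exp/Zadjoin_gen.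
Qed.

(** As [a] is invertible modulo [N], [w] is itself a power of [w ^+ a], so [1 - w] and [1 - w ^+ a]
    divide each other in Z[w]. *)
Lemma Zadjoin_sub1_assoc a : coprime a N ->
  exists u v, [/\ Zadjoin w u, Zadjoin w v, u * v = 1 & 1 - w ^+ a = (1 - w) * u].
Proof.
move=> a_N; have N_gt0 := prim_order_gt0 w_pk.
have [u Zu Du] := Zadjoin_sub1_dvd a.
case: (@egcdnP a N) => [|b c Dab _].
  rewrite lt0n; apply: contraTneq a_N => ->.
  by rewrite /coprime gcd0n -(expn0 p) eqn_exp2l ?prime_gt1.
rewrite (eqP a_N) in Dab.
have Dw : w ^+ a ^+ b = w.
  rewrite -exprM mulnC Dab addn1 exprS mulnC exprM.
  by rewrite (prim_expr_order w_pk) expr1n mulr1.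
exists u, (\sum_(i < b) w ^+ a ^+ i); split=> //.
  by apply: Zadjoin_sum => i _; apply/Zadjoin_exp/Zadjoin_exp/Zadjoin_gen.
have w1_nz : 1 - w != 0.
  rewrite subr_eq0 eq_sym -(expr0 w) -{1}(expr1 w) (eq_prim_root_expr w_pk).
  by rewrite eqn_mod_dvd // subn0 dvdn1 -(expn0 p) eqn_exp2l ?prime_gt1.
apply: (mulfI w1_nz); rewrite mulrA -Du mulr1 -[in RHS]Dw.
by rewrite -[RHS]opprB subrX1 -mulNr opprB.
Qed.

(** Total ramification: [p] is the product of [1 - w ^+ c] over the [c < N] prime to [p], and each
    factor is [1 - w] times a unit. *)
Lemma prime_eq_unit_mul_exp : exists e u v,
  [/\ (0 < e)%N, Zadjoin w u, Zadjoin w v, u * v = 1 & p%:R = (1 - w) ^+ e * u].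
Proof.
have p_gt0 := prime_gt0 p_pr.
pose w1 := w ^+ (p ^ k).
have w1_p : p.-primitive_root w1.
  by have := dvdn_prim_root w_pk (m := p); rewrite expnS mulKn // dvdn_mulr //; apply.
have wp_k : (p ^ k)%N.-primitive_root (w ^+ p).
  have := dvdn_prim_root w_pk (m := (p ^ k)%N).
  by rewrite expnS mulnK ?expn_gt0 ?p_gt0 // dvdn_mull //; apply.
(* For fixed [b] the product over [a] is [1 - w1 ^+ b], where [w1] is a primitive [p]-th root of
   unity. *)
have Dp : \prod_(1 <= b < p) \prod_(0 <= a < p ^ k) (1 - w ^+ (b + p * a)) = p%:R.
  rewrite -(prod_one_sub_prim_root1 w1_p); apply: eq_bigr => b _.
  rewrite /w1 exprAC -(prod_one_sub_prim_root _ wp_k); apply: eq_bigr => a _.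
  by rewrite exprD exprM.
pose good (e : nat) (x : L) := exists u v,
  [/\ Zadjoin w u, Zadjoin w v, u * v = 1 & x = (1 - w) ^+ e * u].
have good1 : good 0 1.
  by exists 1, 1; split; rewrite ?mul1r //; exact: (Zadjoin_nat w 1).
have goodM e f x y : good e x -> good f y -> good (e + f)%N (x * y).
  case=> u [v [Zu Zv uv ->]] [u' [v' [Zu' Zv' uv' ->]]].
  exists (u * u'), (v * v'); split; first exact: Zadjoin_mul.
  - exact: Zadjoin_mul.
  - by rewrite mulrACA uv uv' mul1r.
  by rewrite exprD mulrACA.
have good_prod (s : seq nat) (f : nat -> nat) (F : nat -> L) :
  (forall i, i \in s -> good (f i) (F i)) ->
  good (\sum_(i <- s) f i)%N (\prod_(i <- s) F i).
  elim: s => [|i s IH] gF; first by rewrite !big_nil.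
  rewrite !big_cons; apply: goodM; first by apply/gF/mem_head.
  by apply: IH => j js; apply: gF; rewrite inE js orbT.
have := good_prod (index_iota 1 p) (fun=> \sum_(0 <= a < p ^ k) 1)%N
  (fun b => \prod_(0 <= a < p ^ k) (1 - w ^+ (b + p * a))); rewrite Dp.
case=> [b|u [v [Zu Zv uv DP]]].
  rewrite mem_index_iota => /andP[b_gt0 b_lt]; apply: good_prod => a _.
  case: (@Zadjoin_sub1_assoc (b + p * a)); last by move=> u [v [? ? ? ?]]; exists u, v.
  rewrite coprimeXr // coprime_sym prime_coprime //.
  by rewrite dvdn_addl ?dvdn_mulr // gtnNdvd.
exists (\sum_(1 <= b < p) \sum_(0 <= a < p ^ k) 1)%N, u, v; split => //.
by rewrite !sum_nat_const_nat !subn0 muln1 muln_gt0 expn_gt0 p_gt0 subn_gt0 prime_gt1.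
Qed.

(** The [e]-th power of the equation reads [d ^+ e = p m] with [m = v * y ^+ e] rational and
    integral, hence an integer. *)
Lemma prime_dvd_int_of_dvd (d : int) y :
  integral y -> d%:~R = (1 - w) * y -> (p %| `|d|)%N.
Proof.
move=> Zy Dd; have [e [u [v [e_gt0 Zu Zv uv Dp]]]] := prime_eq_unit_mul_exp.
have p_nz : p%:R != 0 :> L by rewrite natr_neq0 ?prime_gt0.
have Zw := integral_prim_root w_pk.
have De : (d ^+ e)%:~R = p%:R * (v * y ^+ e).
  by rewrite rmorphXn /= Dd exprMn Dp -mulrA (mulrA u) uv mul1r.
have [m Dm] : exists m : int, v * y ^+ e = m%:~R.
  apply: (rational_integral iota).
    have -> : v * y ^+ e = p%:R^-1 * (d ^+ e)%:~R by rewrite De mulKf.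
    by rewrite rpredM ?rpredV ?rpred_nat ?rpred_int.
  by apply: integral_mul (integral_Zadjoin Zw Zv) (integral_exp _ Zy).
move: De; rewrite Dm -[p%:R]/((p : int)%:~R) -rmorphM => De.
have {}De : d ^+ e = (p : int) * m.
  apply: (@intr_inj algC); have := congr1 iota De; by rewrite !rmorph_int.
have := congr1 absz De; rewrite abszX abszM => /= De'.
by have := Euclid_dvdX `|d| e p_pr; rewrite De' dvdn_mulr // e_gt0 andbT => <-.
Qed.

(** Since [w] is 1 modulo [1 - w], a value [q(w)] is [q(1)] modulo [1 - w]. *)
Lemma Zadjoin_horner_sub1 x : Zadjoin w x ->
  exists (d : int) y, Zadjoin w y /\ x = d%:~R + (1 - w) * y.
Proof.
case=> q ->; exists q.[1].
have /factor_theorem[q' Dq] : root (q - q.[1]%:P) 1.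
  by rewrite rootE hornerD hornerN hornerC subrr.
exists (- (map_poly intr q').[w]); split; first by apply: Zadjoin_opp; exists q'.
have := congr1 (fun q0 => (map_poly (intr : int -> L) q0).[w]) Dq.
rewrite rmorphB rmorphM /= map_polyXsubC map_polyC /= hornerD hornerN hornerC.
rewrite hornerM hornerXsubC rmorph1 => /eqP; rewrite subr_eq => /eqP ->.
by rewrite addrC mulrN -mulNr opprB mulrC.
Qed.

(* Writing p = pi^e u with u a unit of Z[w] and pi = 1 - w, the coefficients
   of the pi-adic expansion of p y are multiples of p up to order e. *)
Lemma Zadjoin_prime_div y : integral y -> Zadjoin w (p%:R * y) -> Zadjoin w y.
Proof.
move=> Zy Zpy; have [e [u [v [e_gt0 Zu Zv uv Dp]]]] := prime_eq_unit_mul_exp.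
have p_nz : p%:R != 0 :> L by rewrite natr_neq0 ?prime_gt0.
have Zw := integral_prim_root w_pk; have iZ := integral_Zadjoin Zw.
have Z1w : Zadjoin w (1 - w).
  by apply: Zadjoin_sub (Zadjoin_gen _); exact: (Zadjoin_nat w 1).
have w1_nz : 1 - w != 0.
  by apply: contraNneq p_nz => w1; rewrite Dp w1 expr0n gtn_eqF ?mul0r.
suffices [C [D [ZC ZD Dpy]]] : exists C D, [/\ Zadjoin w C, Zadjoin w D
    & p%:R * y = p%:R * C + (1 - w) ^+ e * D].
  have -> : y = C + v * D; last exact/Zadjoin_add/Zadjoin_mul.
  by apply: (mulfI p_nz); rewrite Dpy mulrDr {3}Dp -!mulrA (mulrA u) uv mul1r.
(* Induction on the exponent [j <= e] of [1 - w], starting from [C = 0] and [D = p y]. *)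
elim: {1 3}e (leqnn e) => [|j IH] j_e.
  exists 0, (p%:R * y); split=> //; first exact: (Zadjoin_nat w 0).
  by rewrite mulr0 add0r expr0 mul1r.
have [C [D [ZC ZD Dpy]]] := IH (ltnW j_e).
have [d [D' [ZD' DD]]] := Zadjoin_horner_sub1 ZD.
(* Cancelling [(1 - w) ^+ j] in the relation, where [p] contributes [(1 - w) ^+ e], shows that
   [1 - w] divides the integer [d] to which [D] reduces. So [p] divides [d], and this part of [D]
   moves into [C]. *)
have /dvdnP[d' Dd'] : (p %| `|d|)%N.
  apply: (@prime_dvd_int_of_dvd d ((1 - w) ^+ (e - j.+1) * u * (y - C) - D')).
    apply: integral_sub; last exact: iZ.
    apply: integral_mul; last by apply: integral_sub Zy (iZ _ ZC).
    by apply: iZ; apply/Zadjoin_mul/Zu/Zadjoin_exp.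
  apply: (mulfI (expf_neq0 j w1_nz)).
  have := Dpy; rewrite DD Dp -{1 2}(subnKC j_e) exprD exprSr => Dpy'.
  have -> : (1 - w) ^+ j * d%:~R = (1 - w) ^+ j * (d%:~R + (1 - w) * D')
     - (1 - w) ^+ j * (1 - w) * D' by ring.
  set X := _ * (d%:~R + _) in Dpy' *.
  have -> : X = (1 - w) ^+ j * (1 - w) * (1 - w) ^+ (e - j.+1) * u * y
     - (1 - w) ^+ j * (1 - w) * (1 - w) ^+ (e - j.+1) * u * C.
    by rewrite Dpy' addrC addKr.
  by ring.
have [d2 Dd] : exists d2 : int, d = d2 * Posz p.
  by apply/dvdzP; rewrite dvdzE /= Dd' dvdn_mull.
exists (C + (1 - w) ^+ j * d2%:~R), D'; split=> //.
  by apply/Zadjoin_add/Zadjoin_mul/Zadjoin_int => //; apply: Zadjoin_exp.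
rewrite Dpy DD Dd rmorphM /= -pmulrn exprSr; ring.
Qed.

(** The traces of [x w^-j] are integers, and Fourier inversion writes [N x] as the sum of these
    traces times [w^j]. So [N x] lies in Z[w], and the factors [p] of [N] are divided out one at a
    time. *)
Theorem ring_of_integers_prim_root x :
  ring_of_integers <<1; w>> x <-> Zadjoin w x.
Proof.
split=> [[Ex Zx]|]; last exact/ring_of_integers_Zadjoin/integral_prim_root/w_pk.
have Zw := integral_prim_root w_pk; have N_gt0 := prim_order_gt0 w_pk.
have Tr_int j : exists n : int, galTrace 1 <<1; w>> (x * w ^- j) = n%:~R.
  apply: (rational_integral iota).
    apply: mem_galTrace (galois_prim_root w_pk) _.
    by rewrite rpredM ?rpredV ?rpredX ?memv_adjoin.
  apply: integral_sum => g _; apply: integral_gal; apply: integral_mul Zx _.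
  have -> : w ^- j = w ^+ (N.-1 * j).
    apply: (mulfI (expf_neq0 j (prim_root_neq0 w_pk))).
    rewrite mulfV ?expf_neq0 ?(prim_root_neq0 w_pk) // -exprD -mulSn prednK //.
    by rewrite exprM (prim_expr_order w_pk) expr1n.
  exact: integral_exp.
have ZNx : Zadjoin w (N%:R * x).
  have -> : N%:R * x = \sum_(j < N) galTrace 1 <<1; w>> (x * w ^- j) * w ^+ j.
    under eq_bigr => j _ do rewrite mulr_suml.
    rewrite exchange_big (bigD1 1%g) //= [X in _ + X]big1 => [|g /andP[_ g_nz]].
      rewrite addr0 mulr_natl -[N in LHS]card_ord -sumr_const; apply: eq_bigr => j _.
      by rewrite gal_id mulfVK ?expf_neq0 ?(prim_root_neq0 w_pk).
    under eq_bigr => j _.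
      rewrite rmorphM /= fmorphV rmorphXn /= -mulrA -exprVn -exprMn. over.
    (* [y] is an [N]-th root of unity other than 1 unless [g] is the identity, so its geometric sum
       vanishes. *)
    rewrite -mulr_sumr; set y := (g w)^-1 * w.
    have : (y - 1) * \sum_(j < N) y ^+ j = 0.
      rewrite -subrX1 exprMn exprVn -rmorphXn (prim_expr_order w_pk) rmorph1.
      by rewrite invr1 mulr1 subrr.
    move/eqP; rewrite mulf_eq0 subr_eq0 => /orP[/eqP y1|/eqP->]; last exact: mulr0.
    case/eqP: g_nz; apply: gal_prim_root_eq; rewrite gal_id.
    have gw_nz : g w != 0 by rewrite fmorph_eq0 (prim_root_neq0 w_pk).
    by apply: (mulfI (invr_neq0 gw_nz)); rewrite mulVf // -/y y1.
  apply: Zadjoin_sum => j _; have [n ->] := Tr_int j.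
  exact/Zadjoin_mul/Zadjoin_exp/Zadjoin_gen/Zadjoin_int.
elim: {1}k.+1 x {Ex Tr_int} Zx ZNx => [|j IH] x Zx ZNx.
  by rewrite expn0 mul1r in ZNx.
apply: Zadjoin_prime_div => //; apply: IH.
  by apply: integral_mul Zx; apply: integral_nat.
by rewrite mulrA -natrM -expnSr.
Qed.

End RingOfIntegers.

(** * Arithmetic modulo powers of p *)

Section Arithmetic.
Local Open Scope nat_scope.

Lemma expn1D_3 x n : exists W, (1 + x) ^ n = 1 + n * x + 'C(n, 2) * x ^ 2 + x ^ 3 * W.
Proof.
elim: n => [|n [W IH]]; first by exists 0; rewrite bin0n expn0; lia.
exists ('C(n, 2) + W + x * W); rewrite expnS IH binS bin1; ring.
Qed.

Variables (p r : nat).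
Hypotheses (p_pr : prime p) (p_odd : odd p) (r_gt0 : 0 < r).

(** Induction by [p]-th powers: [p] is odd, so it divides ['C(p, 2)], and [u] absorbs all terms
    beyond the linear one. This form gives both the congruence for these powers and their exact
    distance from 1. *)
Lemma expn1D_prime_pow m : exists u,
  (1 + p ^ r) ^ (p ^ m) = 1 + p ^ (r + m) * (1 + p ^ r * u).
Proof.
elim: m => [|m [u IH]]; first by exists 0; rewrite expn1 addn0 muln0 addn0 muln1.
rewrite expnSr expnM IH; set x := p ^ (r + m) * _.
have [W ->] := expn1D_3 x p.
have /dvdnP[c ->] : p %| 'C(p, 2).
  apply: prime_dvd_bin; rewrite //= ltn_neqAle prime_gt1 // andbT.
  by apply: contraTneq p_odd => <-.
have [r' Dr] : exists r', r = r'.+1 by exists r.-1; rewrite prednK.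
set y := 1 + p ^ r * u in x *.
exists (u + c * p ^ m * y ^ 2 + p ^ (r' + 2 * m) * y ^ 3 * W).
rewrite /x /y Dr !addnS !addSn !expnS mul2n -addnn !expnD; ring.
Qed.

Lemma expn1D_prime_pow_mod m k : k <= r + m ->
  (1 + p ^ r) ^ (p ^ m) = 1 + p ^ r * p ^ m %[mod p ^ (r + k)].
Proof.
move=> le_k; have [u ->] := expn1D_prime_pow m.
have [d Dd] : exists d, r + m + r = r + k + d by exists (r + m - k); lia.
rewrite -expnD mulnDr muln1 addnA mulnA -expnD Dd (expnD p (r + k)) -mulnA.
by rewrite -modnDmr modnMr addn0.
Qed.

Lemma expn1D_mod b : (1 + p ^ r) ^ b = 1 %[mod p ^ r].
Proof. by rewrite -modnXm modnDr modnXm exp1n. Qed.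

Lemma expn1D_prime_pow_neq1 m :
  (1 + p ^ r) ^ (p ^ m) != 1 %[mod p ^ (r + m).+1].
Proof.
have [u ->] := expn1D_prime_pow m; rewrite eqn_mod_dvd ?leq_addr // addKn.
rewrite expnSr dvdn_pmul2l ?expn_gt0 ?prime_gt0 // dvdn_addl; last first.
  by rewrite dvdn_mulr // dvdn_exp.
by rewrite dvdn1 neq_ltn prime_gt1 ?orbT.
Qed.

(** This will make the Galois group cyclic. The exponent [b] is lifted one power of [p] at a
    time. *)
Lemma expn1D_surj j a : a = 1 %[mod p ^ r] ->
  exists b, (1 + p ^ r) ^ b = a %[mod p ^ (r + j)].
Proof.
move=> a1; elim: j => [|j [b IH]]; first by exists 0; rewrite addn0.
have p_gt1 := prime_gt1 p_pr.
set M := p ^ (r + j) in IH; set X := (1 + p ^ r) ^ b in IH.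
(* When [a < X] the negative correction is replaced by [p - 1] times its absolute value. *)
have [d Dd] : exists d, a = X + d * M %[mod p * M].
  have [le_Xa | /ltnW le_aX] := leqP X a.
    have /dvdnP[d Dd] : M %| a - X by rewrite -eqn_mod_dvd // IH.
    by exists d; rewrite -Dd subnKC.
  have /dvdnP[d Dd] : M %| X - a by rewrite -eqn_mod_dvd // IH.
  exists (p.-1 * d); have -> : X + p.-1 * d * M = d * (p * M) + a.
    by rewrite -(subnKC le_aX) Dd -{2}(prednK (prime_gt0 p_pr)); ring.
  by rewrite modnMDl.
(* The new factor is [1 + d * M] modulo [p * M], and [X] is 1 modulo [p], so the product is
   [X + d * M]. *)
exists (b + p ^ j * d); rewrite addnS expnS -/M Dd expnD expnM -/X.
have [u ->] := expn1D_prime_pow j; rewrite -/M.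
have [W ->] := expn1D_3 (M * (1 + p ^ r * u)) d.
have DX : exists X', X = 1 + p * X'.
  have /eqP := expn1D_mod b; rewrite -/X eqn_mod_dvd ?expn_gt0 // => XX.
  have /dvdnP[X' DX'] : p %| X - 1 by apply: dvdn_trans XX; apply: dvdn_exp.
  by exists X'; rewrite mulnC -DX' subnKC // expn_gt0.
have [X' DX'] := DX; have [r' Dr] : exists r', r = r'.+1 by exists r.-1; rewrite prednK.
have DM : M = p * p ^ (r' + j) by rewrite /M Dr addSn expnS.
have Dpr : p ^ r = p * p ^ r' by rewrite Dr expnS.
set M' := p ^ (r' + j) in DM; set q' := p ^ r' in Dpr.
set C2 := 'C(d, 2).
have -> : X * (1 + d * (M * (1 + p ^ r * u)) + C2 * (M * (1 + p ^ r * u)) ^ 2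
     + (M * (1 + p ^ r * u)) ^ 3 * W)
   = (d * (X' + (1 + p * X') * q' * u) + X * C2 * M' * (1 + p ^ r * u) ^ 2
      + X * M' * M * (1 + p ^ r * u) ^ 3 * W) * (p * M) + (X + d * M).
  by rewrite DX' Dpr DM; ring.
by rewrite modnMDl.
Qed.

Lemma digits_ltn m (c : 'I_m -> 'I_p) : \sum_(i < m) c i * p ^ i < p ^ m.
Proof.
elim: m c => [|m IH] c; first by rewrite big_ord0.
rewrite big_ord_recr /= expnS; have := IH (c \o widen_ord (leqnSn m)).
have := ltn_ord (c ord_max); set q := p ^ m; set S := \sum_(i < m) _; nia.
Qed.

Lemma digits_exist m n : n < p ^ m ->
  exists c : {ffun 'I_m -> 'I_p}, n = \sum_(i < m) c i * p ^ i.
Proof.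
have p_gt0 := prime_gt0 p_pr.
elim: m n => [|m IH] n.
  by exists [ffun i => Ordinal p_gt0]; rewrite big_ord0; lia.
rewrite expnS mulnC -ltn_divLR // => /IH[c Dn].
exists [ffun i => oapp c (Ordinal (ltn_pmod n p_gt0)) (unlift ord0 i)].
rewrite big_ord_recl ffunE unlift_none /= muln1 {1}(divn_eq n p) addnC Dn big_distrl.
congr (_ + _); apply: eq_bigr => i _.
by rewrite ffunE liftK /= /bump /= add1n expnSr mulnA.
Qed.

(** The [c i] are the base [p] digits of [(t - 1) / p]; later arguments use membership in [Rset]
    only in this digit-free form. *)
Lemma mem_Rset k t : 0 < k ->
  (t \in Rset p r k) = (t < p ^ minn r k) && (t == 1 %[mod p]).
Proof.
move=> k_gt0; have p_gt1 := prime_gt1 p_pr.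
have [m Dm] : exists m, minn r k = m.+1 by exists (minn r k).-1; lia.
have sumE (c : {ffun 'I_m -> 'I_p}) :
    1 + \sum_(i < m) c i * p ^ i.+1 = 1 + p * \sum_(i < m) c i * p ^ i.
  by rewrite big_distrr; congr (1 + _); apply: eq_bigr => i _; rewrite expnS mulnCA.
rewrite mem_undup Dm /=; apply/mapP/andP => [[c _ ->] | [lt_t t1]].
  rewrite sumE; split; last by rewrite mulnC addnC modnMDl.
  by have := digits_ltn c; rewrite expnS; set S := \sum_(i < m) _; nia.
have t_gt0 : 0 < t by case: t t1 {lt_t} => // /eqP; rewrite mod0n modn_small.
have /dvdnP[n Dn] : p %| t - 1 by rewrite -eqn_mod_dvd.
have [|c Dc] := @digits_exist m n; first by rewrite expnS in lt_t; nia.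
by exists c; rewrite ?mem_enum // sumE -Dc; lia.
Qed.

End Arithmetic.

(** By the binomial expansion each [p]-th power gains a factor [p] in the modulus. This bounds the
    order of an automorphism whose exponent is 1 modulo [p]. *)
Lemma expn_prime_pow_eq1 p a m : a = 1 %[mod p] -> a ^ (p ^ m) = 1 %[mod p ^ m.+1].
Proof.
move=> a1; elim: m => [|m IH]; first by rewrite expn1.
have [p_le0 | p_gt0] := posnP p.
  by rewrite p_le0 !modn0 in a1 *; rewrite a1 exp1n.
have [M_le1 | M_gt1] := leqP (p ^ m.+1) 1.
  have p1 : p = 1%N.
    apply/eqP; rewrite eqn_leq p_gt0 andbT; apply: leq_trans M_le1.
    by rewrite expnS leq_pmulr // expn_gt0 p_gt0.
  by rewrite p1 !exp1n !modn1.
rewrite (modn_small M_gt1) in IH.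
rewrite expnSr expnM (divn_eq (a ^ p ^ m) (p ^ m.+1)) IH addnC.
have [W ->] := expn1D_3 (a ^ p ^ m %/ p ^ m.+1 * p ^ m.+1) p.
set d := (_ %/ _)%N.
have -> : (1 + p * (d * p ^ m.+1) + 'C(p, 2) * (d * p ^ m.+1) ^ 2
    + (d * p ^ m.+1) ^ 3 * W
  = (d + 'C(p, 2) * d ^ 2 * p ^ m + d ^ 3 * p ^ m * p ^ m.+1 * W) * p ^ m.+2 + 1)%N.
  by rewrite !expnS; ring.
by rewrite modnMDl.
Qed.

Lemma eqmod_mul2l c m a b : coprime c m -> c * a = c * b %[mod m] -> a = b %[mod m].
Proof.
move=> c_m; wlog le_ab : a b / (a <= b)%N => [IH | cab].
  have [/IH // | /ltnW/IH + cab] := leqP a b.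
  by move=> /(_ (esym cab)).
apply/eqP; rewrite eq_sym eqn_mod_dvd // -(@Gauss_dvdr m c) 1?coprime_sym //.
by rewrite mulnBr -eqn_mod_dvd ?leq_mul2l ?le_ab ?orbT // cab.
Qed.

(** * Traces to the subfield of index p - 1 *)

Section TraceExponents.
Variables (L : splittingFieldType rat) (p n : nat) (w : L) (F : {subfield L}).
Hypotheses (p_pr : prime p) (w_n : (p ^ n.+1)%N.-primitive_root w).
Hypotheses (sF : (F <= <<1; w>>)%VS) (dimF : \dim_F <<1; w>> = p.-1).
Local Notation E := <<1; w>>%AS.

Let gexp (g : gal_of E) : nat := sval (aut_prim_rootP g w_n).

Let gexpE (g : gal_of E) : g w = w ^+ gexp g.
Proof. by rewrite /gexp; case: aut_prim_rootP. Qed.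

Let gexp_coprime (g : gal_of E) : coprime (gexp g) p.
Proof.
rewrite /gexp; case: aut_prim_rootP => a /= a_n _.
by rewrite coprime_pexpr in a_n.
Qed.

Let p_dvd : (p %| p ^ n.+1)%N. Proof. by rewrite dvdn_exp. Qed.

Let card_gal : #|'Gal(E / F)%g| = p.-1.
Proof.
rewrite -dimF galois_dim //; apply: galoisS (galois_prim_root w_n).
by rewrite sub1v sF.
Qed.

(* An automorphism with exponent 1 modulo p has p-power order, while the order
   of Gal(E / F) is p - 1. *)
Let gexp_inj : {in 'Gal(E / F)%g &, forall g h, gexp g = gexp h %[mod p] -> g = h}.
Proof.
move=> g h gG hG gh; pose k := (g * h^-1)%g.
have Dg : g = (k * h)%g by rewrite mulgKV.
have Dgexp : gexp g = (gexp h * gexp k)%N %[mod p ^ n.+1].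
  apply/eqP; rewrite -(eq_prim_root_expr w_n) -gexpE {1}Dg galM ?memv_adjoin //.
  by rewrite gexpE rmorphXn /= gexpE -exprM.
have k1 : gexp k = 1 %[mod p].
  apply: (eqmod_mul2l (gexp_coprime h)).
  by rewrite muln1 -gh -(modn_dvdm (gexp g) p_dvd) Dgexp modn_dvdm.
have kX b : (k ^+ b)%g w = w ^+ (gexp k ^ b).
  elim: b => [|b IH]; first by rewrite expg0 gal_id.
  by rewrite expgSr galM ?memv_adjoin // IH rmorphXn /= gexpE -exprM expnS.
have k_p : (k ^+ (p ^ n) = 1)%g.
  apply: gal_prim_root_eq; rewrite kX gal_id -(prim_expr_mod w_n).
  by rewrite expn_prime_pow_eq1 // (prim_expr_mod w_n).
have k_G : k \in 'Gal(E / F)%g by rewrite groupM ?groupV.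
suffices /eqP k_1 : k == 1%g by rewrite Dg k_1 mul1g.
rewrite -order_eq1 -dvdn1; have <- : gcdn (p ^ n) p.-1 = 1%N.
  apply/eqP; apply: coprimeXl; have := coprimenS p.-1.
  by rewrite prednK ?prime_gt0 // coprime_sym.
by rewrite dvdn_gcd order_dvdn k_p eqxx -card_gal order_dvdG.
Qed.

(** The exponents of the [p - 1] automorphisms are nonzero and pairwise distinct modulo [p], so by
    counting they represent every nonzero residue once. The subfield enters later arguments only
    through [T]. *)
Lemma galTrace_exponents : exists T : seq nat, [/\ uniq T,
    forall t, galTrace F <<1; w>> (w ^+ t) = \sum_(a <- T) w ^+ (a * t),
    {in T, forall a, coprime a p}
  & forall j, coprime j p -> exists2 a0, a0 \in T &
      {in T, forall a, (a == j %[mod p]) = (a == a0)}].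
Proof.
have p_gt0 := prime_gt0 p_pr.
exists [seq gexp g | g <- enum 'Gal(E / F)%g]; split.
- rewrite map_inj_in_uniq ?enum_uniq // => g h; rewrite !mem_enum => gG hG gh.
  by apply: gexp_inj => //; rewrite gh.
- move=> t; rewrite big_map big_enum; apply: eq_bigr => g _.
  by rewrite rmorphXn /= gexpE -exprM.
- by move=> _ /mapP[g _ ->]; apply: gexp_coprime.
move=> j j_p; pose f (g : gal_of E) : 'I_p := Ordinal (ltn_pmod (gexp g) p_gt0).
pose o0 : 'I_p := Ordinal p_gt0.
have im_f : f @: 'Gal(E / F)%g = [set~ o0].
  apply/eqP; rewrite eqEcard; apply/andP; split.
    apply/subsetP=> _ /imsetP[g _ ->]; rewrite !inE -val_eqE /=.
    by have := gexp_coprime g; rewrite coprime_sym prime_coprime.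
  rewrite card_in_imset => [|g h gG hG [] gh]; last exact: gexp_inj.
  by rewrite cardsC1 card_ord card_gal.
have : Ordinal (ltn_pmod j p_gt0) \in f @: 'Gal(E / F)%g.
  by rewrite im_f !inE -val_eqE /=; rewrite coprime_sym prime_coprime in j_p.
case/imsetP=> g0 g0G [] Dj; exists (gexp g0); first by rewrite map_f ?mem_enum.
move=> _ /mapP[g gG ->]; rewrite mem_enum in gG; rewrite Dj.
by apply/eqP/eqP=> [/gexp_inj-> | ->].
Qed.

End TraceExponents.

(** * The action of the group algebra *)

Section GroupAlgDelta.
Variables (F : fieldType) (gT : finGroupType).

Definition ga_delta (h : gT) : group_alg F gT := [ffun g => (g == h)%:R].

Lemma group_algE (x : group_alg F gT) : x = \sum_g x g *: ga_delta g.
Proof.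
apply/ffunP=> h.
rewrite (big_morph (fun y : group_alg F gT => y h) (id1 := 0) (op1 := +%R)); first last.
- by rewrite ffunE.
- by move=> y z; rewrite ffunE.
rewrite (bigD1 h) //= !ffunE eqxx mulr1 big1 ?addr0 // => g /negPf g_h.
by rewrite !ffunE eq_sym g_h mulr0.
Qed.

End GroupAlgDelta.

Section GalAct.
Variables (L : splittingFieldType rat) (K E : {subfield L}).
Hypothesis sKE : (K <= E)%VS.
Local Notation G := [subg 'Gal(E / K)].
Implicit Types (x y : gal_alg K E) (g h : G) (c : subvs_of K) (v : L).

Lemma fixed_subg g v : v \in K -> sgval g v = v.
Proof. by move=> Kv; rewrite (fixed_gal sKE) // subgP. Qed.

Lemma subg_galM g h v : v \in E -> sgval (g * h)%g v = sgval h (sgval g v).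
Proof. by move=> Ev; rewrite /= galM. Qed.

Lemma gal_actD x y v : gal_act (x + y) v = gal_act x v + gal_act y v.
Proof.
rewrite /gal_act -big_split; apply: eq_bigr => g _ /=.
by rewrite ffunE linearD /= mulrDl.
Qed.

Lemma gal_act0 v : gal_act (0 : gal_alg K E) v = 0.
Proof. by apply: big1 => g _; rewrite ffunE linear0 mul0r. Qed.

Lemma gal_actN x v : gal_act (- x) v = - gal_act x v.
Proof. by apply/eqP; rewrite -addr_eq0 -gal_actD addNr gal_act0. Qed.

Lemma gal_actB x y v : gal_act (x - y) v = gal_act x v - gal_act y v.
Proof. by rewrite gal_actD gal_actN. Qed.

Lemma gal_actZ c x v : gal_act (c *: x) v = vsval c * gal_act x v.
Proof.
by rewrite /gal_act mulr_sumr; apply: eq_bigr => g _; rewrite ffunE /= mulrA.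
Qed.

Lemma gal_act_sum (I : Type) (s : seq I) (P : pred I) (F : I -> gal_alg K E) v :
  gal_act (\sum_(i <- s | P i) F i) v = \sum_(i <- s | P i) gal_act (F i) v.
Proof.
apply: (big_morph (fun x => gal_act x v)); last exact: gal_act0.
by move=> x y; apply: gal_actD.
Qed.

Lemma gal_act_sumr x (I : Type) (s : seq I) (P : pred I) (F : I -> L) :
  gal_act x (\sum_(i <- s | P i) F i) = \sum_(i <- s | P i) gal_act x (F i).
Proof.
rewrite /gal_act exchange_big; apply: eq_bigr => g _ /=.
by rewrite rmorph_sum mulr_sumr.
Qed.

Lemma gal_actDr x u v : gal_act x (u + v) = gal_act x u + gal_act x v.
Proof.
by rewrite /gal_act -big_split; apply: eq_bigr => g _; rewrite rmorphD mulrDr.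
Qed.

Lemma gal_actMl x a v : a \in K -> gal_act x (a * v) = a * gal_act x v.
Proof.
move=> Ka; rewrite /gal_act mulr_sumr; apply: eq_bigr => g _.
by rewrite rmorphM /= fixed_subg // mulrCA.
Qed.

Lemma gal_act_mem x v : v \in E -> gal_act x v \in E.
Proof.
move=> Ev; apply: memv_suml => g _; rewrite rpredM ?memv_gal //.
exact: (subvP sKE) (subvsP _).
Qed.

Definition gal_delta h : gal_alg K E := ga_delta _ h.

Lemma gal_delta_val h g : gal_delta h g = (g == h)%:R.
Proof. by rewrite ffunE. Qed.

Lemma gal_deltaE x : x = \sum_g x g *: gal_delta g.
Proof. exact: group_algE.
Qed.

Lemma gal_act_delta h v : gal_act (gal_delta h) v = sgval h v.
Proof.
rewrite /gal_act (bigD1 h) //= gal_delta_val eqxx rmorph1 mul1r big1 ?addr0 //.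
by move=> g /negPf g_h; rewrite gal_delta_val g_h linear0 mul0r.
Qed.

Lemma gal_act1 v : gal_act (1 : gal_alg K E) v = v.
Proof. exact: etrans (gal_act_delta 1%g v) (gal_id _ _). Qed.

Lemma galTrace_subg v : galTrace K E v = \sum_(h : G) sgval h v.
Proof.
rewrite /galTrace (reindex_onto (@sgval _ 'Gal(E / K)%G) (subg 'Gal(E / K)%G)).
  by apply: eq_bigl => g; rewrite sgvalK eqxx subgP.
by move=> g gG; apply: subgK.
Qed.

(** Faithfulness of the action is the linear independence of automorphisms. *)
Lemma gal_act_eq0 x : (forall v, v \in E -> gal_act x v = 0) -> x = 0.
Proof.
move=> x0; pose c_ (g : gal_of E) := vsval (x (subg 'Gal(E / K)%G g)).
have c0 (g : gal_of E) : g \in 'Gal(E / K)%g -> c_ g = 0.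
  apply: (gal_independent (P := mem 'Gal(E / K)%g)) => v Ev.
  apply: etrans (x0 v Ev).
  rewrite (reindex_onto (@sgval _ 'Gal(E / K)%G) (subg 'Gal(E / K)%G)).
    apply: eq_big => h; first by rewrite sgvalK eqxx andbT; apply: subgP.
    by rewrite /c_ sgvalK.
  by move=> h hG; apply: subgK.
apply/(@ffunP G (fun=> subvs_of K)) => g; rewrite [RHS]ffunE; apply: subvs_inj.
by have := c0 _ (subgP g); rewrite /c_ sgvalK => ->; rewrite linear0.
Qed.

(** The automorphisms with a prescribed value at [v] form a coset of the stabilizer of [v]. *)
Lemma card_subg_eq h0 v : v \in E ->
  #|[set h : G | sgval h v == sgval h0 v]| = #|[set h : G | sgval h v == v]|.
Proof.
move=> Ev; rewrite -[RHS](card_imset _ (mulIg h0)); apply: eq_card => h.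
rewrite inE; apply/eqP/imsetP => [Dh | [g]].
  exists (h * h0^-1)%g; last by rewrite mulgKV.
  by rewrite inE subg_galM // Dh -subg_galM // mulgV gal_id.
by rewrite inE => /eqP Dg ->; rewrite subg_galM // Dg.
Qed.

Hypothesis abG : abelian 'Gal(E / K).

Lemma subg_mulC g h : (g * h = h * g)%g.
Proof. by apply: val_inj; apply: (centsP abG); apply: subgP. Qed.

(** A product of automorphisms applies its left factor first; commutativity of the group turns this
    into a left action. *)
Lemma gal_actM x y v : v \in E -> gal_act (x * y) v = gal_act x (gal_act y v).
Proof.
move=> Ev; rewrite gal_act_sumr /gal_act.
under eq_bigr => g _ do rewrite ffunE linear_sum mulr_suml.
rewrite exchange_big [RHS]exchange_big; apply: eq_bigr => h _ /=.
rewrite (reindex_inj (mulgI h)) /=; apply: eq_bigr => g _.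
rewrite mulKg rmorphM /= fixed_subg ?subvsP // mulrA; congr (_ * _).
by rewrite -!subg_galM // subg_mulC.
Qed.

Lemma gal_actC x y v : v \in E ->
  gal_act x (gal_act y v) = gal_act y (gal_act x v).
Proof.
move=> Ev; rewrite /gal_act.
under eq_bigr => g _ do rewrite rmorph_sum mulr_sumr.
under [RHS]eq_bigr => g _ do rewrite rmorph_sum mulr_sumr.
rewrite exchange_big; apply: eq_bigr => g _; apply: eq_bigr => h _ /=.
rewrite !rmorphM /= (fixed_subg _ (subvsP (x h))) (fixed_subg _ (subvsP (y g))).
rewrite mulrCA; congr (_ * (_ * _)).
by rewrite -!subg_galM // subg_mulC.
Qed.

(** * Linear extension of characters to the group algebra *)

Variable chi : G -> L.

Definition gal_char x : L := \sum_(g : G) vsval (x g) * chi g.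

Lemma gal_charD x y : gal_char (x + y) = gal_char x + gal_char y.
Proof.
rewrite /gal_char -big_split; apply: eq_bigr => g _ /=.
by rewrite ffunE linearD /= mulrDl.
Qed.

Lemma gal_char0 : gal_char 0 = 0.
Proof. by apply: big1 => g _; rewrite ffunE linear0 mul0r. Qed.

Lemma gal_charB x y : gal_char (x - y) = gal_char x - gal_char y.
Proof. by apply/eqP; rewrite eq_sym subr_eq -gal_charD subrK. Qed.

Lemma gal_char_sum (I : Type) (t : seq I) (P : pred I) (F : I -> gal_alg K E) :
  gal_char (\sum_(i <- t | P i) F i) = \sum_(i <- t | P i) gal_char (F i).
Proof.
exact: (big_morph gal_char gal_charD gal_char0).
Qed.

Lemma gal_charZ c x : gal_char (c *: x) = vsval c * gal_char x.
Proof.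
by rewrite /gal_char mulr_sumr; apply: eq_bigr => g _; rewrite ffunE /= mulrA.
Qed.

Lemma gal_char_delta h : gal_char (gal_delta h) = chi h.
Proof.
rewrite /gal_char (bigD1 h) //= gal_delta_val eqxx rmorph1 mul1r big1 ?addr0 //.
by move=> g /negPf g_h; rewrite gal_delta_val g_h linear0 mul0r.
Qed.

Hypothesis chiM : forall g h, chi (g * h)%g = chi g * chi h.

Lemma gal_charM x y : gal_char (x * y) = gal_char x * gal_char y.
Proof.
rewrite /gal_char mulr_suml.
under eq_bigr => g _ do rewrite ffunE linear_sum mulr_suml.
rewrite exchange_big; apply: eq_bigr => h _ /=; rewrite mulr_sumr.
rewrite (reindex_inj (mulgI h)) /=; apply: eq_bigr => g _.
by rewrite mulKg chiM mulrACA.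
Qed.

Lemma sum_gal_char_eq0 h : chi h != 1 -> \sum_(g : G) chi g = 0.
Proof.
move=> chi_h; apply/eqP.
have : chi h * \sum_(g : G) chi g == \sum_(g : G) chi g.
  rewrite mulr_sumr [eqbRHS](reindex_inj (mulgI h)) /=.
  by apply/eqP/eq_bigr => g _; rewrite chiM.
rewrite -subr_eq0 -{2}[\sum_(g : G) _]mul1r -mulrBl.
by rewrite mulf_eq0 subr_eq0 (negPf chi_h).
Qed.

End GalAct.

(** * The extension K(zt) / K *)

(** Raising to the power [1 + q] stands for [sg]. Its [M]-th iterate multiplies [v] by [eta], which
    it fixes, so [b] iterates split by Euclidean division by [M]. *)
Lemma expr_expn1D_mod (F : comNzRingType) (v eta : F) q M b :
    eta ^+ (1 + q) = eta -> v ^+ ((1 + q) ^ M) = v * eta ->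
  v ^+ ((1 + q) ^ b) = eta ^+ (b %/ M) * v ^+ ((1 + q) ^ (b %% M)).
Proof.
move=> eta_q v_M.
have eta_b c : eta ^+ ((1 + q) ^ c) = eta.
  by elim: c => [|c IH]; rewrite ?expr1 // expnS exprM eta_q.
have v_cM c : v ^+ ((1 + q) ^ (c * M)) = v * eta ^+ c.
  elim: c => [|c IH]; first by rewrite mul0n expn0 expr1 mulr1.
  by rewrite mulSn expnD exprM v_M exprMn IH eta_b -mulrA -exprSr.
by rewrite {1}(divn_eq b M) expnD exprM v_cM exprMn mulrC -exprM mulnC exprM eta_b.
Qed.

Section CyclotomicExtension.
Variables (L : splittingFieldType rat) (iota : {rmorphism L -> algC}).
Variables (p r s : nat) (z0 zt : L).
Hypotheses (p_pr : prime p) (p_odd : odd p) (r_gt0 : (0 < r)%N).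
Hypotheses (zt_n : (p ^ (r + s))%N.-primitive_root zt) (Dz0 : z0 = zt ^+ (p ^ s)).

Local Notation K := <<1; z0>>%AS.
Local Notation E := <<1; zt>>%AS.
Local Notation G := [subg 'Gal(E / K)].
Local Notation q := (p ^ r)%N.
Local Notation integral := (integralOver (intr : int -> L)).
Local Notation om := (zt ^+ q).
Implicit Types (x y : gal_alg K E) (g h : G).

Let p_gt0 : (0 < p)%N. Proof. exact: prime_gt0. Qed.

Lemma z0_prim : q.-primitive_root z0.
Proof.
have := dvdn_prim_root zt_n (m := q); rewrite expnD mulKn ?expn_gt0 ?p_gt0 //.
by rewrite Dz0 dvdn_mulr //; apply.
Qed.

Lemma om_prim : (p ^ s)%N.-primitive_root om.
Proof.
have := dvdn_prim_root zt_n (m := (p ^ s)%N); rewrite expnD mulnK ?expn_gt0 ?p_gt0 //.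
by rewrite dvdn_mull //; apply.
Qed.

Lemma sub_KE : (K <= E)%VS.
Proof.
apply/FadjoinP; split; first exact: subv_adjoin.
by rewrite Dz0 rpredX ?memv_adjoin.
Qed.

Lemma galois_KE : galois K E.
Proof. by apply: galoisS (galois_prim_root zt_n); rewrite sub1v sub_KE. Qed.

Lemma abelian_KE : abelian 'Gal(E / K).
Proof. exact: abelianS (galS _ (sub1v _)) (abelian_gal_prim_root zt_n). Qed.

Lemma zt_E i : zt ^+ i \in E.
Proof. by rewrite rpredX ?memv_adjoin. Qed.

Lemma z0_K i : z0 ^+ i \in K.
Proof. by rewrite rpredX ?memv_adjoin. Qed.

Lemma ztX_K i : (p ^ s %| i)%N -> zt ^+ i \in K.
Proof. by case/dvdnP=> j ->; rewrite mulnC exprM -Dz0 z0_K. Qed.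

Lemma subg_zt_inj g h : sgval g zt = sgval h zt -> g = h.
Proof. by move=> gh; apply/val_inj/gal_prim_root_eq. Qed.

Lemma gal_z0 (g : gal_of E) a : g zt = zt ^+ a -> g z0 = z0 ^+ a.
Proof. by move=> Dg; rewrite Dz0 rmorphXn /= Dg exprAC. Qed.

Lemma subg_zt_exp g : exists2 a, a = 1 %[mod q] & sgval g zt = zt ^+ a.
Proof.
have [a _ Da] := aut_prim_rootP (sgval g) zt_n; exists a => //.
have := fixed_subg sub_KE g (z0_K 1); rewrite expr1 (gal_z0 Da).
by rewrite -[RHS]expr1 => /eqP; rewrite (eq_prim_root_expr z0_prim) => /eqP.
Qed.

(** The exponent [a] is prime to [p], so it defines an automorphism over the rationals; being 1
    modulo [q], it fixes [z0] and hence [K]. *)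
Lemma subg_zt_exists a : a = 1 %[mod q] -> exists g, sgval g zt = zt ^+ a.
Proof.
move=> a1; have [|g gE Dg] := gal_prim_root_exists zt_n iota (a := a).
  rewrite coprimeXr // coprime_sym prime_coprime //.
  have p_q : (p %| q)%N by rewrite dvdn_exp.
  rewrite /dvdn -(modn_dvdm a p_q) a1 modn_dvdm //.
  by rewrite modn_small ?prime_gt1.
have gK : g \in 'Gal(E / K)%g.
  rewrite gal_kHom ?sub_KE //; apply/kAHomP=> _ /Fadjoin_polyP[_ /polyOver1P[f ->] ->].
  rewrite -horner_map /= -map_poly_comp (gal_z0 Dg).
  rewrite -(prim_expr_mod z0_prim) a1 (prim_expr_mod z0_prim) expr1; congr (_.[_]).
  by apply: eq_map_poly => b /=; rewrite linearZ /= rmorph1.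
by exists (subg _ g); rewrite subgK.
Qed.

Variable sg : G.
Hypothesis Dsg : sgval sg zt = zt ^+ (1 + q).

Lemma sgX_zt b : sgval (sg ^+ b)%g zt = zt ^+ ((1 + q) ^ b).
Proof.
elim: b => [|b IH]; first by rewrite expg0 gal_id expr1.
by rewrite expgSr subg_galM ?memv_adjoin // IH rmorphXn /= Dsg -exprM -expnS.
Qed.

Lemma subg_cyclic g : exists b, (sg ^+ b)%g == g.
Proof.
have [a a1 Da] := subg_zt_exp g.
have [b Db] := expn1D_surj p_pr p_odd r_gt0 s a1.
exists b; apply/eqP/subg_zt_inj; rewrite sgX_zt Da.
by rewrite -(prim_expr_mod zt_n) Db (prim_expr_mod zt_n).
Qed.

Lemma order_sg : #[sg]%g = (p ^ s)%N.
Proof.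
have : (#[sg]%g %| p ^ s)%N.
  rewrite order_dvdn; apply/eqP/subg_zt_inj; rewrite sgX_zt gal_id.
  rewrite -(prim_expr_mod zt_n) (expn1D_prime_pow_mod p_pr p_odd r_gt0) ?leq_addl //.
  by rewrite -expnD modnDr (prim_expr_mod zt_n) expr1.
case/(dvdn_pfactor _ _ p_pr)=> m le_ms Dm; rewrite Dm; congr (p ^ _)%N.
apply/eqP; rewrite eqn_leq le_ms leqNgt; apply/negP => lt_ms.
have /eqP : (sg ^+ (p ^ m))%g = 1%g by rewrite -Dm expg_order.
apply/negP; apply: contra (expn1D_prime_pow_neq1 p_pr p_odd r_gt0 m).
move/eqP/(congr1 (fun g : G => sgval g zt)); rewrite sgX_zt gal_id => /eqP.
rewrite -[X in _ == X]expr1 (eq_prim_root_expr zt_n) => e.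
have dv : (p ^ (r + m).+1 %| p ^ (r + s))%N by rewrite dvdn_exp2l // -addnS leq_add2l.
by rewrite -(modn_dvdm _ dv) (eqP e) modn_dvdm.
Qed.

(** * Discrete logarithms to base [sg] and the morphisms [psi l] *)

Lemma lg_sig g : {b | (sg ^+ b)%g == g}.
Proof. exact: sigW (subg_cyclic g). Qed.

Definition lg g : nat := sval (lg_sig g).

Lemma sg_lg g : (sg ^+ lg g)%g = g.
Proof. exact/eqP/(svalP (lg_sig g)). Qed.

Lemma subg_zt g : sgval g zt = zt ^+ ((1 + q) ^ lg g).
Proof. by rewrite -{1}(sg_lg g) sgX_zt. Qed.

Lemma lg_sgX b : lg (sg ^+ b)%g = b %[mod p ^ s].
Proof.
by apply/eqP; rewrite -order_sg -eq_expg_mod_order; rewrite sg_lg.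
Qed.

Lemma om_lgM l g h : om ^+ (l * lg (g * h)%g) = om ^+ (l * lg g) * om ^+ (l * lg h).
Proof.
rewrite -exprD -mulnDr ![(l * _)%N]mulnC !exprM; congr (_ ^+ l).
have Dgh : (sg ^+ (lg g + lg h))%g = (g * h)%g.
  apply: subg_zt_inj; rewrite sgX_zt subg_galM ?memv_adjoin // (subg_zt g).
  rewrite rmorphXn /= (subg_zt h) -exprM mulnC.
  by rewrite -expnD.
apply/eqP; rewrite (eq_prim_root_expr om_prim) -(lg_sgX (lg g + lg h)).
by rewrite Dgh.
Qed.

Definition psi l : gal_alg K E -> L := gal_char (fun g : G => om ^+ (l * lg g)).

Lemma psi_delta_sgX l b : psi l (gal_delta (sg ^+ b)%g) = om ^+ l ^+ b.
Proof.
rewrite /psi gal_char_delta -[om ^+ l ^+ b]exprM; apply/eqP.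
by rewrite (eq_prim_root_expr om_prim) -modnMmr lg_sgX modnMmr.
Qed.

Lemma psiB l x y : psi l (x - y) = psi l x - psi l y.
Proof. exact: gal_charB. Qed.

Lemma psiZ l (a : subvs_of K) x : psi l (a *: x) = vsval a * psi l x.
Proof. exact: gal_charZ. Qed.

Lemma psi_sum l (I : Type) (t : seq I) (P : pred I) (F : I -> gal_alg K E) :
  psi l (\sum_(i <- t | P i) F i) = \sum_(i <- t | P i) psi l (F i).
Proof. exact: gal_char_sum. Qed.

Lemma psi1 l : psi l 1 = 1.
Proof. exact: etrans (psi_delta_sgX l 0) (expr0 _). Qed.

Lemma psiM l x y : psi l (x * y) = psi l x * psi l y.
Proof. by apply: gal_charM => g h; apply: om_lgM. Qed.

(** Here [p ^ (s - k)] is the gcd of [l] and [p ^ s]. *)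
Lemma om_level l : exists k j,
  [/\ (k <= s)%N, l = (p ^ (s - k) * j)%N & (p ^ k)%N.-primitive_root (om ^+ l)].
Proof.
have := exp_prim_root om_prim l.
have [m le_ms Dm] : exists2 m, (m <= s)%N & gcdn l (p ^ s) = (p ^ m)%N.
  by apply/(dvdn_pfactor _ _ p_pr)/dvdn_gcdr.
have /dvdnP[j Dj] := dvdn_gcdl l (p ^ s); rewrite Dm in Dj *.
rewrite -expnB // => om_l; exists (s - m)%N, j; split; rewrite ?leq_subr //.
by rewrite subKn // mulnC.
Qed.

Lemma om_exp_zt l : om ^+ l = zt ^+ l ^+ q.
Proof. exact: exprAC. Qed.

(* The kernel of psi l is generated by sg^M - th^M, where th = om^l has order
   p^k and M = p^(k - r) (truncated subtraction), and this element kills zt^l. *)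
Lemma psi_ker l x : psi l x = 0 -> gal_act x (zt ^+ l) = 0.
Proof.
have [k [j [le_ks Dl]]] := om_level l.
set th := om ^+ l => th_k; set v := zt ^+ l; pose M := (p ^ (k - r))%N.
have M_gt0 : (0 < M)%N by rewrite expn_gt0 p_gt0.
pose eta := th ^+ M.
have eta_v : eta = v ^+ (q * M) by rewrite /eta /th om_exp_zt -exprM.
(* The exponent of [zt] in [eta] is a multiple of [p ^ s], since [s - k + r + (k - r)] is at least
   [s] even with truncated subtraction. *)
have [i Di] : exists i, eta = z0 ^+ i.
  exists (p ^ (r + (s - k) + (k - r) - s) * j)%N.
  rewrite eta_v /v -exprM Dz0 -exprM; congr (zt ^+ _).
  rewrite Dl /M [RHS]mulnA -(expnD p s).
  have -> : (s + (r + (s - k) + (k - r) - s) = r + (s - k) + (k - r))%N by lia.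
  by rewrite !expnD; ring.
have eta_q : eta ^+ (1 + q) = eta.
  by rewrite Di exprD expr1 exprAC (prim_expr_order z0_prim) expr1n mulr1.
have eta_K : eta \in K by rewrite Di z0_K.
have v_ord : v ^+ (p ^ (r + k)) = 1.
  rewrite /v Dl -exprM mulnAC -expnD mulnC.
  have -> : (s - k + (r + k) = r + s)%N by lia.
  by rewrite mulnC exprM (prim_expr_order zt_n) expr1n.
(* The order of [v] divides [p ^ (r + k)], modulo which [(1 + q) ^ M] is [1 + q * M] because
   [k <= r + (k - r)]. *)
have v_M : v ^+ ((1 + q) ^ M) = v * eta.
  rewrite eta_v -exprS -add1n -[LHS](expr_mod _ v_ord) -[RHS](expr_mod _ v_ord).
  rewrite expn1D_prime_pow_mod //; lia.
(* These are the coefficients of the remainder of [x], seen as a polynomial in [sg], modulo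
   [sg^M - eta]. *)
pose C (c : nat) : L :=
  \sum_(g : G | (lg g %% M)%N == c) vsval (x g) * eta ^+ (lg g %/ M)%N.
have part (F : nat -> L) :
    \sum_(g : G) vsval (x g) * (eta ^+ (lg g %/ M)%N * F (lg g %% M)%N) =
    \sum_(c < M) C c * F c.
  rewrite (partition_big (fun g => Ordinal (ltn_pmod (lg g) M_gt0)) xpredT) //=.
  apply: eq_bigr => c _; rewrite mulr_suml; apply: eq_big => g //=.
  by move=> /eqP <-; rewrite mulrA.
have -> : gal_act x v = \sum_(c < M) C c * v ^+ ((1 + q) ^ c).
  rewrite -(part (fun c => v ^+ ((1 + q) ^ c))); apply: eq_bigr => g _.
  rewrite -expr_expn1D_mod // /v rmorphXn /=; congr (_ * _).
  by rewrite (subg_zt g) exprAC.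
have -> : psi l x = \sum_(c < M) C c * th ^+ c.
  rewrite -(part (fun c => th ^+ c)); apply: eq_bigr => g _.
  by rewrite -[eta ^+ _]exprM -exprD [(M * _)%N]mulnC -divn_eq exprM.
move=> psi_x0; pose P := \poly_(c < M) C c.
suffices P0 : P = 0.
  apply: big1 => c _; have := congr1 (fun f : {poly L} => f`_c) P0.
  by rewrite coef_poly ltn_ord coef0 => ->; rewrite mul0r.
have P_K : P \is a polyOver K.
  apply/polyOver_poly => c _; apply: memv_suml => g _.
  by apply: rpredM; [exact: subvsP | apply: rpredX eta_K].
have P_th : root P th by rewrite rootE horner_poly psi_x0.
(* [P] has degree below [M] and coefficients in [K], so along with [th] it has these [M] distinct
   conjugates as roots. *)
pose rs := [seq th ^+ (1 + q * c) | c <- seq.iota 0 M].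
have rs_root : all (root P) rs.
  apply/allP=> _ /mapP[c _ ->].
  have [g Dg] : exists g, sgval g zt = zt ^+ (1 + q * c).
    by apply: subg_zt_exists; rewrite addnC mulnC modnMDl.
  rewrite -(fixedPoly_gal sub_KE (subgP g) P_K).
  have -> : th ^+ (1 + q * c) = sgval g th.
    by rewrite /th /= !rmorphXn /= Dg -!exprM; congr (zt ^+ _); ring.
  exact: rmorph_root.
have rs_uniq : uniq rs.
  rewrite map_inj_in_uniq ?iota_uniq // => c c'; rewrite !mem_iota !add0n.
  move=> /andP[_ lt_c] /andP[_ lt_c'] /eqP; rewrite (eq_prim_root_expr th_k) eqn_modDl.
  have [le_kr | lt_rk] := leqP k r.
    have M1 : M = 1%N by rewrite /M (eqP le_kr).
    by move: lt_c lt_c'; rewrite M1 !ltnS !leqn0 => /eqP-> /eqP->.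
  rewrite -(subnKC (ltnW lt_rk)) expnD -!muln_modr eqn_pmul2l ?expn_gt0 ?p_gt0 //.
  by rewrite !modn_small // => /eqP.
apply: (roots_geq_poly_eq0 rs_root rs_uniq).
by rewrite size_map size_iota size_poly.
Qed.

Lemma integral_zt i : integral (zt ^+ i).
Proof. exact/integral_exp/integral_prim_root/zt_n. Qed.

(* O_(K(om^l)) = O_K[om^l], so psi l x is also the image of an element of
   O_K[G], and by psi_ker both elements act in the same way on zt^l. *)
Lemma integral_act_psi l x : integral (psi l x) -> integral (gal_act x (zt ^+ l)).
Proof.
move=> Zpsi; have [k [j [le_ks Dl th_k]]] := om_level l.
suffices [y Zy Dy] : exists2 y, forall v, integral v -> integral (gal_act y v)
    & psi l y = psi l x.
  have /eqP : gal_act (x - y) (zt ^+ l) = 0.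
    by apply: psi_ker; rewrite psiB -Dy subrr.
  by rewrite gal_actB subr_eq0 => /eqP ->; apply/Zy/integral_zt.
(* For [k <= r] the root [om ^+ l] lies in [K], and [y] can be the scalar [psi l x]. *)
have [le_kr | lt_rk] := leqP k r.
  have th_K : om ^+ l \in K.
    rewrite -exprM Dl mulnA -expnD; apply: ztX_K.
    by rewrite dvdn_mulr // dvdn_exp2l //; lia.
  have psi_K : psi l x \in K.
    apply: memv_suml => g _; rewrite exprM.
    by apply: rpredM; [exact: subvsP | apply: rpredX th_K].
  exists (vsproj K (psi l x) *: gal_delta (sg ^+ 0)%g) => [v Zv|].
    rewrite gal_actZ gal_act_delta vsprojK //.
    exact: integral_mul Zpsi (integral_gal _ Zv).
  by rewrite psiZ psi_delta_sgX expr0 mulr1 vsprojK.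
(* For [k > r] the field [K(om^l)] is generated over the rationals by [om ^+ l], so its integers are
   integer polynomials in [om ^+ l], and [y] is such a polynomial in [sg]. *)
have [i Di] : exists i, z0 = om ^+ l ^+ i.
  have [|i ->] := prim_rootP th_k (x := z0); last by exists i.
  by rewrite -(subnKC (ltnW lt_rk)) expnD exprM (prim_expr_order z0_prim) expr1n.
have sK : (K <= <<1; om ^+ l>>)%VS.
  apply/FadjoinP; split; first exact: subv_adjoin.
  by rewrite {1}Di; apply/rpredX/memv_adjoin.
have psi_th : psi l x \in <<1; om ^+ l>>%VS.
  apply: memv_suml => g _; rewrite exprM; apply: rpredM.
    exact: (subvP sK) (subvsP _).
  by apply/rpredX/memv_adjoin.
rewrite -(ltn_predK lt_rk) in th_k.
have [f Df] := (ring_of_integers_prim_root iota p_pr th_k _).1 (conj psi_th Zpsi).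
exists (\sum_(i < size f) (f`_i)%:~R *: gal_delta (sg ^+ i)%g) => [v Zv|].
  rewrite gal_act_sum; apply: integral_sum => b _.
  rewrite gal_actZ gal_act_delta rmorph_int.
  exact: integral_mul (integral_int _ _) (integral_gal _ Zv).
rewrite Df horner_coef size_map_inj_poly ?rmorph0 //; last first.
  move=> m n mn; apply: (@intr_inj algC).
  by have := congr1 iota mn; rewrite !rmorph_int.
rewrite psi_sum; apply: eq_bigr => b _.
by rewrite psiZ psi_delta_sgX rmorph_int coef_map.
Qed.

(** The integers of [E] form Z[zt], so the action only has to be tested on powers of [zt]. *)
Lemma associated_order_psi x :
  (forall l, integral (psi l x)) -> associated_order x.
Proof.
move=> Zpsi y [Ey Zy]; split; first exact: gal_act_mem sub_KE _ _ Ey.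
have zt_n' := zt_n; have n_gt0 : (0 < r + s)%N by rewrite addn_gt0 r_gt0.
rewrite -(ltn_predK n_gt0) in zt_n'.
have [f ->] := (ring_of_integers_prim_root iota p_pr zt_n' y).1 (conj Ey Zy).
rewrite horner_coef gal_act_sumr; apply: integral_sum => i _.
rewrite gal_actMl ?sub_KE //; last by rewrite coef_map /= rpred_int.
rewrite coef_map; apply: integral_mul (integral_int _ _) _.
exact: integral_act_psi.
Qed.

(** Determinant trick: multiplication by [psi l x] preserves the finitely generated Z[z0]-module
    [psi l Lam], so [psi l x] is a root of a characteristic polynomial with integral
    coefficients. *)
Lemma integral_psi_order Lam l x :
  is_order (@integers_in L K) Lam -> Lam x -> integral (psi l x).
Proof.
case=> Lam1 _ LamM [n [b LamP]] _ Lam_x.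
have Lam_b i : Lam (b i).
  apply/LamP; exists (fun j => (j == i)%:R); split.
    move=> j; split; first exact: subvsP.
    by rewrite rmorph_nat; apply: integral_nat.
  rewrite (bigD1 i) //= eqxx scale1r big1 ?addr0 // => j /negPf->.
  by rewrite scale0r.
have z0_r := z0_prim; rewrite -(ltn_predK r_gt0) in z0_r.
have span y : Lam y -> exists F : {ffun 'I_n -> {poly int}},
    psi l y = \sum_j (map_poly intr (F j)).[z0] * psi l (b j).
  case/LamP=> f [f_int Dy].
  have /fin_all_exists[F DF] j :
      exists m : {poly int}, vsval (f j) = (map_poly intr m).[z0].
    exact: ((ring_of_integers_prim_root iota p_pr z0_r _).1 (f_int j)).
  exists (finfun F); rewrite Dy psi_sum; apply: eq_bigr => j _.
  by rewrite psiZ DF ffunE.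
have /fin_all_exists[F DF] i := span _ (LamM _ _ Lam_x (Lam_b i)).
(* Z[z0] is represented as the image of [{poly int}] under evaluation at [z0]. [M] is transposed
   because eigenvectors are rows. *)
pose ev : {rmorphism {poly int} -> L} := horner_eval z0 \o map_poly intr.
pose M : 'M[{poly int}]_n := \matrix_(i, j) F j i.
apply: (@integral_root_monic _ _ _ _ (map_poly ev (char_poly M))).
- exact/monic_map/char_poly_monic.
- rewrite map_char_poly -eigenvalue_root_char; apply/eigenvalueP.
  exists (\row_i psi l (b i)).
    apply/rowP=> i; rewrite !mxE -psiM DF; apply: eq_bigr => j _.
    by rewrite !mxE mulrC.
  (* The eigenvector is nonzero because its entries generate [psi l 1 = 1]. *)
  apply/eqP=> /rowP b0; have [f] := span _ Lam1; rewrite psi1 => /eqP.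
  rewrite big1 ?oner_eq0 // => j _.
  by have := b0 j; rewrite !mxE => ->; rewrite mulr0.
apply/integral_poly => i; rewrite coef_map.
apply: (@integral_Zadjoin _ z0); last by exists (char_poly M)`_i.
exact: integral_prim_root z0_prim.
Qed.

(** * Idempotents of conjugacy classes of roots of unity *)

Lemma sum_om_lg m :
  \sum_(g : G) om ^+ (m * lg g) = if om ^+ m == 1 then #|[set: G]|%:R else 0.
Proof.
case: ifPn => [/eqP om_m | om_m].
  under eq_bigr do rewrite exprM om_m expr1n.
  by rewrite cardsT sumr_const.
apply: (@sum_gal_char_eq0 _ _ _ (fun g : G => om ^+ (m * lg g)) _ sg).
  by move=> g h; apply: om_lgM.
rewrite (_ : om ^+ _ = om ^+ m) //; apply/eqP; rewrite (eq_prim_root_expr om_prim).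
by rewrite -modnMmr (lg_sgX 1) modnMmr muln1.
Qed.

Definition om_conj i l := [exists h : G, sgval h (om ^+ i) == om ^+ l].

(** The trace in [om_idem] meets every conjugate of [om ^+ i] this many times, which its denominator
    corrects. *)
Definition om_stab i := #|[set h : G | sgval h (om ^+ i) == om ^+ i]|.

(* The indicator function of the K-conjugates of om^i on the p^s-th roots of
   unity, as a polynomial in sg; i * (p^s - 1) stands for the exponent - i. *)
Definition om_idem i : gal_alg K E := [ffun g : G =>
  vsproj K ((#|[set: G]| * om_stab i)%:R^-1
            * galTrace K E (om ^+ (i * (p ^ s).-1 * lg g)))].

Lemma om_E i : om ^+ i \in E.
Proof. by rewrite -exprM zt_E. Qed.

(** Expanding the trace gives a double sum over [h] and [g]. By orthogonality the sum over [g] is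
    the group order if [h] maps [om ^+ i] to [om ^+ l] and 0 otherwise; such [h] form a coset of the
    stabilizer or do not exist. *)
Lemma psi_om_idem i l : psi l (om_idem i) = (om_conj i l)%:R.
Proof.
have stab_gt0 : (0 < om_stab i)%N.
  by apply/card_gt0P; exists 1%g; rewrite inE gal_id.
have card_gt0 : (0 < #|[set: G]|)%N by rewrite cardG_gt0.
have -> : psi l (om_idem i) = (#|[set: G]| * om_stab i)%:R^-1 * 
    \sum_(h : G) \sum_(g : G) om ^+ (((1 + q) ^ lg h * (i * (p ^ s).-1) + l) * lg g).
  rewrite exchange_big mulr_sumr; apply: eq_bigr => g _ /=.
  rewrite ffunE vsprojK; last first.
    apply: rpredM; first by rewrite rpredV rpred_nat.
    by apply: mem_galTrace galois_KE (om_E _).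
  rewrite -mulrA; congr (_ * _); rewrite galTrace_subg mulr_suml.
  apply: eq_bigr => h _; rewrite !rmorphXn /= (subg_zt h) -!exprM -exprD.
  by congr (zt ^+ _); ring.
have om_h h : (om ^+ ((1 + q) ^ lg h * (i * (p ^ s).-1) + l) == 1)
    = (sgval h (om ^+ i) == om ^+ l).
  rewrite exprD mulnA [(_ * i)%N]mulnC exprM.
  have -> : om ^+ (i * (1 + q) ^ lg h) = sgval h (om ^+ i).
    by rewrite !rmorphXn /= (subg_zt h) -!exprM; congr (zt ^+ _); ring.
  set y := sgval h _; have y_ord : y ^+ (p ^ s) = 1.
    by rewrite -rmorphXn /= (exprAC om i) (prim_expr_order om_prim) expr1n rmorph1.
  have y_nz : y != 0.
    apply: contra_eq_neq y_ord => ->; rewrite expr0n gtn_eqF ?expn_gt0 ?p_gt0 //.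
    by rewrite eq_sym oner_eq0.
  rewrite -(inj_eq (mulfI y_nz)) mulrA -exprS prednK ?expn_gt0 ?p_gt0 // y_ord.
  by rewrite mul1r mulr1 eq_sym.
under eq_bigr => h _ do rewrite sum_om_lg om_h.
pose S := [set h : G | sgval h (om ^+ i) == om ^+ l].
have card_S : #|S| = (om_conj i l * om_stab i)%N.
  rewrite /om_conj; case: existsP => [[h0 /eqP Dh0] | no_h]; last first.
    rewrite mul0n; apply: eq_card0 => h; rewrite inE; apply/negP => hi.
    by case: no_h; exists h.
  by rewrite mul1n /om_stab -(card_subg_eq h0 (om_E i)) Dh0.
rewrite -big_mkcond (eq_bigl (fun h => h \in S)) => [|h]; last by rewrite inE.
rewrite sumr_const card_S -(mulr_natr #|[set: G]|%:R (_ * _)) !natrM invfM.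
have nz1 : (#|[set: G]|%:R : L) != 0 by apply: natr_neq0.
have nz2 : ((om_stab i)%:R : L) != 0 by apply: natr_neq0.
by rewrite mulrACA mulVf // mul1r mulrCA mulVf ?mulr1.
Qed.

Lemma om_idem_order i : associated_order (om_idem i).
Proof.
by apply: associated_order_psi => l; rewrite psi_om_idem; apply: integral_nat.
Qed.

(** Subtracting from [om_idem i] its value under [psi l] gives an element of the kernel of [psi l],
    which kills [zt ^+ l]. *)
Lemma om_idem_act i l :
  gal_act (om_idem i) (zt ^+ l) = (om_conj i l)%:R * zt ^+ l.
Proof.
have /eqP : gal_act (om_idem i - (om_conj i l)%:R *: 1) (zt ^+ l) = 0.
  by apply: psi_ker; rewrite psiB psiZ psi1 psi_om_idem mulr1 rmorph_nat subrr.
by rewrite gal_actB gal_actZ gal_act1 subr_eq0 rmorph_nat => /eqP.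
Qed.

(** * Closure properties of the associated order *)

Lemma associated_orderB x y :
  associated_order x -> associated_order y -> associated_order (x - y).
Proof.
move=> Ax Ay v Ov; have [Ex Zx] := Ax v Ov; have [Ey Zy] := Ay v Ov.
by rewrite gal_actB; split; [apply: rpredB | apply: integral_sub].
Qed.

Lemma associated_orderM x y :
  associated_order x -> associated_order y -> associated_order (x * y).
Proof.
move=> Ax Ay v Ov; rewrite (gal_actM sub_KE abelian_KE) //; last by case: Ov.
exact/Ax/Ay.
Qed.

Lemma associated_orderZ (a : subvs_of K) x :
  integers_in a -> associated_order x -> associated_order (a *: x).
Proof.
move=> [Ka Za] Ax v Ov; have [Ex Zx] := Ax v Ov; rewrite gal_actZ; split.
  by apply: rpredM Ex; apply: (subvP sub_KE).
exact: integral_mul.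
Qed.

Lemma associated_order_sum (I : Type) (t : seq I) (F : I -> gal_alg K E) :
  (forall i, associated_order (F i)) -> associated_order (\sum_(i <- t) F i).
Proof.
move=> AF v Ov; rewrite gal_act_sum; split.
  by apply: memv_suml => i _; case: (AF i v Ov).
by apply: integral_sum => i _; case: (AF i v Ov).
Qed.

Lemma associated_order_delta g : associated_order (gal_delta g).
Proof.
move=> v [Ev Zv]; rewrite gal_act_delta.
by split; [apply: memv_gal | apply: integral_gal].
Qed.

Lemma ring_of_integers_zt v : ring_of_integers E v <-> Zadjoin zt v.
Proof.
have n_gt0 : (0 < r + s)%N by rewrite addn_gt0 r_gt0.
have zt_n' := zt_n; rewrite -(ltn_predK n_gt0) in zt_n'.
exact: (ring_of_integers_prim_root iota p_pr zt_n' v).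
Qed.

Lemma integers_in_int (n : int) : integers_in (n%:~R : subvs_of K).
Proof.
by split; [exact: subvsP | rewrite rmorph_int; apply: integral_int].
Qed.

(** * Conjugacy over [K] in terms of exponents *)

Lemma om_conj_intro i l a :
  a = 1 %[mod q] -> (i * a = l %[mod p ^ s])%N -> om_conj i l.
Proof.
move=> /subg_zt_exists[h Dh] ia; apply/existsP; exists h.
have -> : sgval h (om ^+ i) = om ^+ (i * a).
  by rewrite !rmorphXn /= Dh -!exprM; congr (zt ^+ _); ring.
by rewrite (eq_prim_root_expr om_prim) ia.
Qed.

Lemma om_conj_elim i l : om_conj i l ->
  exists2 a, a = 1 %[mod q] & (i * a = l %[mod p ^ s])%N.
Proof.
case/existsP=> h /eqP Dh; have [a a1 Da] := subg_zt_exp h; exists a => //; apply/eqP.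
rewrite -(eq_prim_root_expr om_prim) -Dh !rmorphXn /= Da -!exprM.
by apply/eqP; congr (zt ^+ _); ring.
Qed.

Lemma om_level_prim k j : (k <= s)%N -> coprime j p ->
  (p ^ k)%N.-primitive_root (om ^+ (p ^ (s - k) * j)).
Proof.
move=> le_ks j_p; rewrite exprM prim_root_exp_coprime ?coprimeXr //.
have := dvdn_prim_root om_prim (m := (p ^ k)%N).
by rewrite -expnB // dvdn_exp2l //; apply.
Qed.

Lemma om_level_cases i : om ^+ i = 1 \/ exists k j,
  [/\ (0 < k)%N, (k <= s)%N, coprime j p & i = (p ^ (s - k) * j)%N].
Proof.
have [[|k] [j [le_ks Di om_i]]] := om_level i.
  by left; rewrite -[LHS]expr1 (prim_expr_order om_i).
right; exists k.+1, j; split=> //; move: om_i; rewrite Di exprM.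
rewrite prim_root_exp_coprime ?coprime_pexpr //.
by rewrite -[(p ^ (s - _))%N]muln1; apply: om_level_prim; rewrite ?coprime1n.
Qed.

(** Conjugacy means [j' = j a] modulo [p ^ k] for some [a] that is 1 modulo [p ^ r]. For [k <= r]
    this forces [j' = j]; for [k > r] the only candidate is [j' / j], and it must be 1 modulo
    [p ^ r]. *)
Lemma om_conj_level k j j' : (k <= s)%N -> coprime j p ->
  om_conj (p ^ (s - k) * j) (p ^ (s - k) * j') = (j == j' %[mod p ^ minn r k]).
Proof.
move=> le_ks j_p; have Ds : (p ^ s = p ^ (s - k) * p ^ k)%N by rewrite -expnD subnK.
apply/idP/eqP => [/om_conj_elim[a a1] | jj'].
  move/eqP; rewrite -mulnA Ds -!muln_modr eqn_pmul2l ?expn_gt0 ?p_gt0 // => /eqP ja.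
  have dk : (p ^ minn r k %| p ^ k)%N by rewrite dvdn_exp2l // geq_minr.
  have dr : (p ^ minn r k %| p ^ r)%N by rewrite dvdn_exp2l // geq_minl.
  rewrite -(modn_dvdm j' dk) -ja modn_dvdm // -modnMmr -(modn_dvdm a dr) a1.
  by rewrite modn_dvdm // modnMmr muln1.
have [le_kr | lt_rk] := leqP k r.
  rewrite (minn_idPr le_kr) in jj'; apply: (@om_conj_intro _ _ 1) => //.
  by rewrite muln1 Ds -!muln_modr jj'.
rewrite (minn_idPl (ltnW lt_rk)) in jj'.
have [b Db] : exists b, (j * b = 1 %[mod p ^ k])%N.
  have j_gt0 : (0 < j)%N.
    rewrite lt0n; apply: contraTneq j_p => ->.
    by rewrite /coprime gcd0n gtn_eqF ?prime_gt1.
  have [b c Dbc _] := egcdnP (p ^ k) j_gt0.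
  exists b; rewrite mulnC Dbc modnMDl.
  by have /eqP -> : coprime j (p ^ k) by rewrite coprimeXr.
have dr : (p ^ r %| p ^ k)%N by rewrite dvdn_exp2l // ltnW.
apply: (@om_conj_intro _ _ (b * j')).
  by rewrite -modnMmr -jj' modnMmr mulnC -(modn_dvdm _ dr) Db modn_dvdm.
rewrite Ds -mulnA -!muln_modr; congr (_ * _)%N.
by rewrite mulnA -modnMml Db modnMml mul1n.
Qed.

Lemma om_conj_prim i l m : om_conj i l ->
  m.-primitive_root (om ^+ i) -> m.-primitive_root (om ^+ l).
Proof. by case/existsP=> h /eqP <-; rewrite fmorph_primitive_root. Qed.

Lemma om_conj_level_neq i l k k' : om_conj i l ->
  (p ^ k)%N.-primitive_root (om ^+ i) -> (p ^ k')%N.-primitive_root (om ^+ l) -> k = k'.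
Proof.
move=> il /(om_conj_prim il) om_l om_l'; apply: (expnI (prime_gt1 p_pr)).
apply/eqP; rewrite eqn_dvd (prim_order_dvd om_l) (prim_expr_order om_l') eqxx.
by rewrite (prim_order_dvd om_l') (prim_expr_order om_l) eqxx.
Qed.

(** * The powers of [zt] in [alpha] and the classes they represent *)

Section Alpha.
Variables (Lsub : nat -> {subfield L}) (z : nat -> L).
Hypothesis Dz : forall k, (k <= s)%N -> z k = zt ^+ (p ^ (s - k)).
Hypothesis hLsub : forall k, (1 <= k <= s)%N ->
  (Lsub k <= <<1; z k>>)%VS /\ \dim_(Lsub k) <<1; z k>> = p.-1.

Lemma coprime_Rset k t : (0 < k)%N -> t \in Rset p r k -> coprime t p.
Proof.
move=> k_gt0; rewrite mem_Rset // => /andP[_ /eqP t1].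
rewrite coprime_sym prime_coprime // /dvdn t1 modn_small ?prime_gt1 //.
Qed.

Lemma trace_exponents k : (1 <= k <= s)%N -> exists T : seq nat, [/\ uniq T,
    forall t, galTrace (Lsub k) <<1; z k>> (z k ^+ t)
      = \sum_(a <- T) zt ^+ (p ^ (s - k) * (a * t)),
    {in T, forall a, coprime a p}
  & forall j, coprime j p -> exists2 a0, a0 \in T &
      {in T, forall a, (a == j %[mod p]) = (a == a0)}].
Proof.
move=> k_s; have [sL dL] := hLsub k_s; have [k_gt0 le_ks] := andP k_s.
have n_gt0 : (0 < r + k)%N by rewrite addn_gt0 r_gt0.
have zk_n : (p ^ (r + k).-1.+1)%N.-primitive_root (z k).
  rewrite (ltn_predK n_gt0) Dz //.
  have := dvdn_prim_root zt_n (m := (p ^ (r + k))%N).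
  rewrite -expnB ?leq_add2l // subnDl dvdn_exp2l ?leq_add2l //; exact.
have [T [uT trT cT exT]] := galTrace_exponents p_pr zk_n sL dL.
exists T; split=> // t; rewrite trT; apply: eq_bigr => a _.
by rewrite Dz // -exprM.
Qed.

(* The exponents a t of the terms of level k represent every unit modulo
   p^(min(r, k)) exactly once. *)
Lemma trace_exponents_unique k (T : seq nat) j : (0 < k)%N -> coprime j p ->
    {in T, forall a, coprime a p} ->
    (forall j, coprime j p -> exists2 a0, a0 \in T &
      {in T, forall a, (a == j %[mod p]) = (a == a0)}) ->
  exists a0 t0, [/\ a0 \in T, t0 \in Rset p r k &
    forall a t, a \in T -> t \in Rset p r k ->
      (j == (a * t)%N %[mod p ^ minn r k]) = (t == t0) && (a == a0)].
Proof.
move=> k_gt0 j_p cT exT; have [a0 Ta0 Da0] := exT j j_p.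
have m_gt0 : (0 < minn r k)%N by rewrite leq_min r_gt0 k_gt0.
set m := minn r k in m_gt0 *.
have p_m : (p %| p ^ m)%N by rewrite dvdn_exp.
have a0_m : coprime a0 (p ^ m) by rewrite coprimeXr // cT.
(* [a0] is determined by [j] modulo [p], and [t0] is then [j / a0] modulo [p ^ m]. *)
have [b Db] : exists b, (a0 * b = j %[mod p ^ m])%N.
  have a0_gt0 : (0 < a0)%N.
    rewrite lt0n; apply: contraTneq (cT _ Ta0) => ->.
    by rewrite /coprime gcd0n gtn_eqF ?prime_gt1.
  have [b c Dbc _] := egcdnP (p ^ m) a0_gt0.
  exists (b * j)%N; rewrite mulnA (mulnC a0) Dbc (eqP a0_m).
  by rewrite mulnDl mul1n mulnAC modnMDl.
have t0_R : (b %% p ^ m)%N \in Rset p r k.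
  rewrite mem_Rset // -/m ltn_pmod ?expn_gt0 ?p_gt0 //= modn_dvdm //.
  apply/eqP/(eqmod_mul2l (cT _ Ta0)); rewrite muln1.
  rewrite -(modn_dvdm (a0 * b) p_m) Db modn_dvdm //.
  by apply/esym/eqP; rewrite Da0.
exists a0, (b %% p ^ m)%N; split=> // a t Ta Rt.
have /andP[lt_t /eqP t1] : (t < p ^ m)%N && (t == 1 %[mod p]) by rewrite -mem_Rset.
apply/eqP/andP => [jat | [/eqP -> /eqP ->]]; last by rewrite modnMmr.
have /eqP Da : a == a0.
  rewrite -Da0 //; apply/eqP; rewrite -(modn_dvdm j p_m) jat modn_dvdm //.
  by rewrite -modnMmr t1 modnMmr muln1.
split; last exact/eqP.
rewrite -(modn_small lt_t); apply/eqP/(eqmod_mul2l a0_m).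
by rewrite Db jat Da.
Qed.

Lemma ring_of_integers_alpha : ring_of_integers E (alpha p r Lsub z s).
Proof.
apply: ring_of_integers_Zadjoin (integral_prim_root zt_n) _.
apply: Zadjoin_add; first exact: (Zadjoin_nat _ 1).
rewrite big_nat; apply: Zadjoin_sum => k k_s; rewrite big_seq.
have [T [_ trT _ _]] := trace_exponents k_s.
apply: Zadjoin_sum => t _; rewrite trT; apply: Zadjoin_sum => a _.
exact/Zadjoin_exp/Zadjoin_gen.
Qed.

(** The idempotent keeps the terms of [alpha] in the class of [om ^+ i]. If [om ^+ i] is 1, only the
    leading term 1 survives; if it has order [p ^ k], only level [k] contributes, by exactly one
    term. *)
Lemma alpha_idem i : exists2 l, om_conj i l
  & gal_act (om_idem i) (alpha p r Lsub z s) = zt ^+ l.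
Proof.
pose lev k := \sum_(t <- Rset p r k) galTrace (Lsub k) <<1; z k>> (z k ^+ t).
have lev_act k T : (forall t, galTrace (Lsub k) <<1; z k>> (z k ^+ t)
      = \sum_(a <- T) zt ^+ (p ^ (s - k) * (a * t))) ->
    gal_act (om_idem i) (lev k) = \sum_(t <- Rset p r k) \sum_(a <- T)
      (om_conj i (p ^ (s - k) * (a * t)))%:R * zt ^+ (p ^ (s - k) * (a * t)).
  move=> trT; rewrite gal_act_sumr; apply: eq_bigr => t _.
  by rewrite trT gal_act_sumr; apply: eq_bigr => a _; apply: om_idem_act.
have lev0 k : (1 <= k <= s)%N ->
    (forall j, coprime j p -> om_conj i (p ^ (s - k) * j) = false) ->
    gal_act (om_idem i) (lev k) = 0.
  move=> k_s noc; have [T [_ trT cT _]] := trace_exponents k_s.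
  rewrite (lev_act _ _ trT) big_seq big1 // => t Rt; rewrite big_seq big1 // => a Ta.
  rewrite noc ?mul0r // coprimeMl cT //=; apply: coprime_Rset Rt.
  by case/andP: k_s.
have -> : gal_act (om_idem i) (alpha p r Lsub z s)
    = (om_conj i 0)%:R + \sum_(1 <= k < s.+1) gal_act (om_idem i) (lev k).
  have := om_idem_act i 0; rewrite expr0 mulr1 => act1.
  by rewrite gal_actDr gal_act_sumr act1.
have [om_i | [k [j [k_gt0 le_ks j_p Di]]]] := om_level_cases i.
  have conj_i l : om_conj i l -> om ^+ l = 1.
    by case/existsP=> h /eqP <-; rewrite om_i rmorph1.
  have conj_i0 : om_conj i 0.
    by apply/existsP; exists 1%g; rewrite gal_id om_i expr0.
  exists 0%N => //; rewrite conj_i0 big_nat big1 ?addr0 // => k k_s.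
  apply: lev0 => // j j_p; apply: (introF idP) => c_ij; have om_l := conj_i _ c_ij.
  have [k_gt0 le_ks] := andP k_s; have := om_level_prim le_ks j_p.
  move/prim_order_dvd/(_ 1%N); rewrite expr1 om_l eqxx dvdn1 -(expn0 p).
  by rewrite eqn_exp2l ?prime_gt1 // gtn_eqF.
have om_i : (p ^ k)%N.-primitive_root (om ^+ i) by rewrite Di; apply: om_level_prim.
have k_s : (1 <= k <= s)%N by rewrite k_gt0.
have [T [uT trT cT exT]] := trace_exponents k_s.
have [a0 [t0 [Ta0 Rt0 Dat]]] := trace_exponents_unique k_gt0 j_p cT exT.
have Dconj a t : a \in T -> t \in Rset p r k ->
    om_conj i (p ^ (s - k) * (a * t)) = (t == t0) && (a == a0).
  by move=> Ta Rt; rewrite Di om_conj_level // Dat.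
exists (p ^ (s - k) * (a0 * t0))%N; first by rewrite Dconj // !eqxx.
have -> : om_conj i 0 = false.
  apply: (introF idP) => /om_conj_prim/(_ om_i); rewrite expr0.
  move/prim_order_dvd/(_ 1%N); rewrite expr1n eqxx dvdn1 -(expn0 p).
  by rewrite eqn_exp2l ?prime_gt1 // gtn_eqF.
rewrite add0r (bigD1_seq k) ?iota_uniq ?mem_index_iota //=.
rewrite [X in _ + X]big1_seq; last first.
  move=> k' /andP[k'_k]; rewrite mem_index_iota => k'_s; apply: lev0 => // j' j'_p.
  apply: (introF idP) => ii; case/eqP: k'_k; apply/esym/(om_conj_level_neq ii om_i).
  by apply: om_level_prim => //; case/andP: k'_s.
rewrite addr0 (lev_act _ _ trT) (bigD1_seq t0) ?undup_uniq //=.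
rewrite [X in _ + X]big1_seq; last first.
  move=> t /andP[/negPf t_t0 Rt]; rewrite big1_seq // => a /andP[_ Ta].
  by rewrite Dconj // t_t0 mul0r.
rewrite addr0 (bigD1_seq a0) //= big1_seq => [|a /andP[/negPf a_a0 Ta]].
  by rewrite addr0 Dconj // !eqxx mul1r.
by rewrite Dconj // a_a0 andbF mul0r.
Qed.

End Alpha.

(** * Generation of the integers by one element, and maximality *)

Variable al : L.
Hypotheses (al_int : ring_of_integers E al)
  (al_idem : forall i, exists2 l, om_conj i l & gal_act (om_idem i) al = zt ^+ l).

(** The idempotent extracts some [zt ^+ l] from [al]. A translate of it has the same [q]-th power as
    [zt ^+ i], so the two differ by a [q]-th root of unity, which is a power of [z0] and an integer
    of [K]. *)
Lemma al_generates_zt i : exists2 a : gal_alg K E,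
  associated_order a & gal_act a al = zt ^+ i.
Proof.
have [l /existsP[h /eqP Dh] Dal] := al_idem i.
have Dh' : sgval h^-1%g (om ^+ l) = om ^+ i.
  by rewrite -Dh -subg_galM ?om_E // mulgV gal_id.
pose u := zt ^+ i / sgval h^-1%g (zt ^+ l).
have h_nz : sgval h^-1%g (zt ^+ l) != 0.
  by rewrite fmorph_eq0 expf_neq0 // (prim_root_neq0 zt_n).
have [|j Du] := prim_rootP z0_prim (x := u).
  rewrite /u expr_div_n -rmorphXn /= -!om_exp_zt Dh' divff //.
  by rewrite expf_neq0 // (prim_root_neq0 om_prim).
exists (vsproj K (z0 ^+ j) *: (gal_delta h^-1%g * om_idem i)).
  apply: associated_orderZ; last first.
    apply: associated_orderM; [exact: associated_order_delta|exact: om_idem_order].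
  split; first exact: subvsP.
  rewrite vsprojK ?z0_K //; exact/integral_exp/integral_prim_root/z0_prim.
rewrite gal_actZ (gal_actM sub_KE abelian_KE); last by case: al_int.
by rewrite gal_act_delta Dal vsprojK ?z0_K // -Du /u divfK.
Qed.

Lemma Zadjoin_eq_act v : Zadjoin zt v <->
  exists2 a : gal_alg K E, associated_order a & v = gal_act a al.
Proof.
split=> [[f ->] | [a Aa ->]]; last exact/ring_of_integers_zt/Aa.
rewrite horner_coef; set n := size _.
have /fin_all_exists2[a Aa Da] (i : 'I_n) := al_generates_zt i.
exists (\sum_(i < n) (f`_i)%:~R *: a i).
  by apply: associated_order_sum => i; apply: associated_orderZ (integers_in_int _) _.
rewrite gal_act_sum; apply: eq_bigr => i _.
by rewrite gal_actZ Da rmorph_int coef_map.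
Qed.

(** By commutativity an element that kills [al] kills all powers of [zt], hence [E], and
    faithfulness applies. *)
Lemma gal_act_al_inj x y : gal_act x al = gal_act y al -> x = y.
Proof.
move=> xy; apply/eqP; rewrite -subr_eq0; apply/eqP/gal_act_eq0 => v.
have act0 : gal_act (x - y) al = 0 by rewrite gal_actB xy subrr.
case/Fadjoin_polyP=> _ /polyOver1P[f ->] ->; rewrite horner_coef gal_act_sumr.
apply: big1 => i _; rewrite (gal_actMl sub_KE); last first.
  by rewrite coef_map; apply: (subvP (sub1v K)); apply: rpredZ; apply: rpred1.
have [a _ <-] := al_generates_zt i.
rewrite (gal_actC sub_KE abelian_KE) ?act0; last by case: al_int.
by rewrite /gal_act big1 ?mulr0 // => g _; rewrite rmorph0 mulr0.
Qed.

Lemma is_order_associated_order : is_order (@integers_in L K) (@associated_order L K E).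
Proof.
split=> [v Ov||||x]; rewrite ?gal_act1 //.
- exact: associated_orderB.
- exact: associated_orderM.
- pose N := (p ^ (r + s))%N; have N_gt0 := prim_order_gt0 zt_n.
  (* Acting on [al] identifies the associated order with Z[zt]; the generators [b i] correspond to
     the powers [zt ^+ i] with [i < N]. *)
  have /fin_all_exists2[b Ab Db] (i : 'I_N) := al_generates_zt i.
  exists N, b => x; split=> [Ax | [a [a_int ->]]]; last first.
    by apply: associated_order_sum => i; apply: associated_orderZ.
  have [f Df] := (ring_of_integers_zt _).1 (Ax _ al_int).
  (* The polynomial [f] may have large degree, so its exponents are folded modulo the order [N] of
     [zt]. *)
  pose m (i : 'I_N) : int := \sum_(j < size f | (j %% N)%N == i) f`_j.
  exists (fun i => (m i)%:~R); split=> [i|]; first exact: integers_in_int.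
  apply: gal_act_al_inj; rewrite Df gal_act_sum horner_coef.
  rewrite size_map_inj_poly ?rmorph0 //; last first.
    move=> a b' ab; apply: (@intr_inj algC).
    by have := congr1 iota ab; rewrite !rmorph_int.
  rewrite (partition_big (fun j : 'I__ => Ordinal (ltn_pmod j N_gt0)) xpredT) //=.
  apply: eq_bigr => i _; rewrite gal_actZ Db rmorph_int /m rmorph_sum mulr_suml.
  apply: eq_big => j //= /eqP <-.
  by rewrite coef_map /= (prim_expr_mod zt_n).
exists #|G|, (fun i => x (enum_val i)), (fun i => gal_delta (enum_val i)).
split=> [i|]; first exact: associated_order_delta.
by rewrite {1}(gal_deltaE x) big_enum_val.
Qed.

Lemma order_sub_associated_order Lam x :
  is_order (@integers_in L K) Lam -> Lam x -> associated_order x.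
Proof.
by move=> oL Lx; apply: associated_order_psi => l; apply: integral_psi_order oL Lx.
Qed.

Lemma associated_order_unique_maximal :
  is_unique_maximal_order (@integers_in L K) (@associated_order L K E).
Proof.
split; first split; first exact: is_order_associated_order.
  by move=> Lam oL _ x; apply: order_sub_associated_order.
move=> M [oM maxM] x; split; first exact: order_sub_associated_order.
apply: maxM; first exact: is_order_associated_order.
by move=> y; apply: order_sub_associated_order.
Qed.

Lemma leopoldt_zt : is_leopoldt K E.
Proof.
split; first exact: sub_KE.
- exact: galois_prim_root zt_n.
- exact: abelian_gal_prim_root zt_n.
exists 1%N, (fun=> al); split=> // v Ov.
have [a Aa Dv] := (Zadjoin_eq_act v).1 ((ring_of_integers_zt v).1 Ov).
exists [ffun=> a]; split.
  by split=> [i|]; rewrite ?big_ord1 ffunE.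
move=> b [Ab]; rewrite big_ord1 Dv => /gal_act_al_inj ab.
by apply/ffunP=> i; rewrite ffunE ab [i]ord1.
Qed.

End CyclotomicExtension.

(* The number fields of the statement are realized as subfields of a number
   field L, Galois over the rationals and embedded by iota in the complex
   algebraic numbers; z k is the element zeta_(p ^ (r + k)) of L, and Lsub k
   is the field L_(r + k). *)
Theorem theorem8p2
  (zeta : nat -> algC) (hzeta : compatible_roots_of_unity zeta)
  (p r s : nat) (hp : prime p) (hodd : odd p) (hr : (1 <= r)%N)
  (h3 : p = 3%N -> (minn 2 s <= r)%N)
  (L : splittingFieldType rat) (iota : {rmorphism L -> algC})
  (z : nat -> L)
  (hz : forall k, (k <= s)%N -> iota (z k) = zeta (p ^ (r + k))%N)
  (Lsub : nat -> {subfield L})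
  (hLsub : forall k, (1 <= k <= s)%N ->
     (Lsub k <= <<1; z k>>)%VS /\ \dim_(Lsub k) <<1; z k>> = p.-1) :
  let K : {subfield L} := <<1; z 0%N>>%AS in
  let E : {subfield L} := <<1; z s>>%AS in
  [/\ is_unique_maximal_order (@integers_in L K) (@associated_order L K E),
      forall x : L, Zadjoin (z s) x <->
        exists2 a : gal_alg K E,
          associated_order a & x = gal_act a (alpha p r Lsub z s)
    & is_leopoldt K E].
Proof.
move=> K E; have [zeta_prim zeta_exp] := hzeta.
have p_gt0 := prime_gt0 hp.
have z_prim k : (k <= s)%N -> (p ^ (r + k))%N.-primitive_root (z k).
  move=> le_ks; rewrite -(fmorph_primitive_root iota) hz //.
  by apply: zeta_prim; rewrite expn_gt0 p_gt0.
have Dz k : (k <= s)%N -> z k = z s ^+ (p ^ (s - k)).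
  move=> le_ks; apply: (fmorph_inj iota); rewrite rmorphXn /= !hz //.
  rewrite -(zeta_exp (p ^ (r + k)) (p ^ (r + s)))%N ?expn_gt0 ?p_gt0 //.
    by rewrite -expnB ?leq_add2l // subnDl.
  by rewrite dvdn_exp2l ?leq_add2l.
have zt_n := z_prim s (leqnn s).
have Dz0 : z 0%N = z s ^+ (p ^ s) by rewrite Dz // subn0.
(* The generator [sg] comes from the exponent [1 + p ^ r], which is 1 modulo [p ^ r]. *)
have [sg Dsg] := subg_zt_exists iota hp hr zt_n Dz0 (modnDr 1 (p ^ r)).
have al_int := ring_of_integers_alpha hp hr zt_n Dz hLsub.
have al_idem := alpha_idem iota hp hodd hr zt_n Dz0 Dsg Dz hLsub.
split.
- exact: associated_order_unique_maximal al_int al_idem.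
- exact: Zadjoin_eq_act al_int al_idem.
- exact: leopoldt_zt al_int al_idem.
Qed.
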